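(* Let $A\in\mathbb{R}^{d\times n}_{\geq 0}$ be a nonnegative matrix of rank $d$ with no zero column. Let $\phi:\mathrm{pos}(A)\to\mathbb{R}^n_{>0}$, $b\mapsto x^*(b)$, be the map sending $b$ to the Santaló point of $P_b=\{x\in\mathbb{R}^n_{\geq0}:Ax=b\}$, and let $\mathrm{SP}(A)$ be its image (the Santaló patchwork). For every cell $C\in\mathcal{C}_A$ of the chamber complex of $A$, the restriction $$\phi|_{C\cap\mathrm{pos}(A)}:C\cap\mathrm{pos}(A)\to S_C$$ is a homeomorphism, where $S_C$ is the Santaló patch of $C$. In particular, the Santaló patchwork is the union of the Santaló patches: $$\mathrm{SP}(A)=\bigcup_{C\in\mathcal{C}_A}S_C,$$ where the union is taken over the cells of $\mathcal{C}_A$.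
   Context: $\mathrm{pos}(A)$ is the image of $\mathbb{R}^n_{>0}$ under $A:\mathbb{R}^n\to\mathbb{R}^d$, the interior of $\mathrm{cone}(A)$, the convex cone generated by the columns of $A$. For $b\in\mathrm{pos}(A)$, $P_b$ is an $(n-d)$-dimensional polytope. Fix $B\in\mathbb{R}^{n\times(n-d)}$ whose columns form a basis of $\ker A$, and put $Q_b=B^T\cdot P_b\subset\mathbb{R}^{n-d}$, a full-dimensional polytope. Santaló point: for a full-dimensional polytope $Q\subset\mathbb{R}^m$ and $y\in\mathrm{int}(Q)$, $(Q-y)^\circ=\{z\in(\mathbb{R}^m)^\vee:\langle y'-y,z\rangle\leq 1\text{ for all }y'\in Q\}$; $y\mapsto\mathrm{vol}_m(Q-y)^\circ$ is strictly convex on $\mathrm{int}(Q)$ with a unique minimizer. $x^*(b)$ is the unique minimizer of $\mathrm{vol}_{n-d}(Q_b-B^Tx)^\circ$ over $x$ in the relative interior of $P_b$. Chamber complex: for $\sigma\subset[n]=\{1,\dots,n\}$ let $A_\sigma$ be the submatrix of $A$ with columns indexed by $\sigma$. For $b\in\mathrm{cone}(A)$, $C_b=\bigcap_{\sigma:\,b\in\mathrm{cone}(A_\sigma)}\mathrm{cone}(A_\sigma)$, and $\mathcal{C}_A=\{C_b:b\in\mathrm{cone}(A)\}$. A cell is a full-dimensional chamber. Notation for a cell $C$: for $b\in\mathrm{int}(C)$ the polytope $P_b$ is simple, every vertex has exactly $n-d$ zero coordinates, and the following data do not depend on $b\in\mathrm{int}(C)$. $\mathcal{F}_C\subset[n]$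 is the set of $i$ such that $P_b\cap\{x_i=0\}$ is a facet of $P_b$. For a vertex $v$, $I(v)\subset\mathcal{F}_C$ is the $(n-d)$-element set of indices of the facets containing $v$; $\mathcal{V}_C$ is the set of all $I(v)$. With $x_I=\prod_{i\in I}x_i$, set $$\alpha_C(x)=\sum_{I(v)\in\mathcal{V}_C}|\det A_{[n]\setminus I(v)}|\cdot x_{\mathcal{F}_C\setminus I(v)}.$$ $B_C$ is the submatrix of $B$ with rows indexed by $\mathcal{F}_C$. The Santaló patch of $C$ is $$S_C=\left\{x\in\mathbb{R}^n_{>0}:\ Ax\in C\cap\mathrm{pos}(A)\ \text{ and }\ B_C^T\cdot\left(\frac{\partial_{x_i}\alpha_C}{\alpha_C}-\frac1{x_i}\right)_{i\in\mathcal{F}_C}=0\right\}.$$ *)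

(* Defs.v *)
From HB Require Import structures.
From mathcomp Require Import all_boot all_order all_algebra.
From mathcomp Require Import all_classical all_reals all_analysis.

Set Implicit Arguments.
Unset Strict Implicit.
Unset Printing Implicit Defensive.

Import Order.TTheory GRing.Theory Num.Theory.
Import numFieldNormedType.Exports.

Local Open Scope classical_set_scope.
Local Open Scope ring_scope.

Section Convex.
Variable R : realType.

Definition dotp (m : nat) (u v : 'cV[R]_m) : R := (u^T *m v) 0 0.

Definition aff_hull (m : nat) (S : set 'cV[R]_m) : set 'cV[R]_m :=
  [set x | exists k (p : 'I_k -> 'cV[R]_m) (w : 'I_k -> R),
     [/\ forall i, S (p i), \sum_(i < k) w i = 1 &
         x = \sum_(i < k) w i *: p i]].

(* The affine hull of the empty set is empty, so [aff_dim set0 k] never holds. *)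
Definition aff_dim (m : nat) (S : set 'cV[R]_m) (k : nat) : Prop :=
  exists (x0 : 'cV[R]_m) (V : 'M[R]_(m, k)),
    \rank V = k /\ aff_hull S = [set x0 + V *m c | c in [set: 'cV[R]_k]].

Definition relint (m : nat) (S : set 'cV[R]_m) : set 'cV[R]_m :=
  [set x | S x /\ \forall y \near x, aff_hull S y -> S y].

Definition is_face (m : nat) (P F : set 'cV[R]_m) : Prop :=
  F !=set0 /\ exists (c : 'cV[R]_m) (e : R),
    (forall x, P x -> dotp c x <= e) /\ F = P `&` [set x | dotp c x = e].

Definition is_vertex (m : nat) (P : set 'cV[R]_m) (v : 'cV[R]_m) : Prop :=
  is_face P [set v].

Definition is_facet (m : nat) (P F : set 'cV[R]_m) : Prop :=
  is_face P F /\ exists k, aff_dim P k.+1 /\ aff_dim F k.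

(* (Q - y)^o, with the dual of R^m identified with R^m by [dotp]. *)
Definition polar_at (m : nat) (Q : set 'cV[R]_m) (y : 'cV[R]_m) :
    set 'cV[R]_m :=
  [set z | forall y', Q y' -> dotp (y' - y) z <= 1].

(* m-dimensional Lebesgue measure, as the m-fold product of [lebesgue_measure]
   on R: the successor case is what [(mu1 \x mu2) S], i.e. the integral of the
   mu2-measures of the sections of S, unfolds to.  R^0 is a point of mass 1. *)
Fixpoint vol (m : nat) : set 'cV[R]_m -> \bar R :=
  match m with
  | 0 => fun S => (\1_S (0 : 'cV[R]_0))%:E
  | m'.+1 => fun S =>
      (\int[lebesgue_measure]_(t in [set: R])
         vol [set y : 'cV[R]_m' | S (col_mx (t%:M : 'cV[R]_1) y)])%E
  end.

End Convex.

Section Homeo.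
Variables T U : topologicalType.

Definition homeomorphism_on (D : set T) (E : set U) (f : T -> U) : Prop :=
  exists g : U -> T,
    [/\ set_fun D E f, set_fun E D g, {in D, cancel f g}, {in E, cancel g f} &
        {within D, continuous f} /\ {within E, continuous g}].

End Homeo.

Section Santalo.
Variables (R : realType) (d n : nat).
Variables (A : 'M[R]_(d, n)) (B : 'M[R]_(n, n - d)).

Definition orthant_pos (k : nat) : set 'cV[R]_k := [set x | forall i, 0 < x i 0].
Definition orthant_ge0 (k : nat) : set 'cV[R]_k := [set x | forall i, 0 <= x i 0].

(* The columns of B form a basis of the kernel of x |-> A *m x.  [kermx] and
   [row_free] are about row vectors, hence the transpositions. *)
Definition is_ker_basis : Prop :=
  row_free B^T /\ (B^T :=: kermx A^T)%MS.

Definition pos : set 'cV[R]_d := [set A *m x | x in @orthant_pos n].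

Definition cone (k : nat) (M : 'M[R]_(d, k)) : set 'cV[R]_d :=
  [set M *m x | x in @orthant_ge0 k].

Definition colsel (s : {set 'I_n}) : 'M[R]_(d, #|s|) :=
  colsub (fun j : 'I_#|s| => enum_val j) A.

Definition fiber (b : 'cV[R]_d) : set 'cV[R]_n :=
  [set x | @orthant_ge0 n x /\ A *m x = b].

Definition Qpoly (b : 'cV[R]_d) : set 'cV[R]_(n - d) :=
  [set B^T *m x | x in fiber b].

Definition is_santalo_point (b : 'cV[R]_d) (x : 'cV[R]_n) : Prop :=
  relint (fiber b) x /\
  forall x', relint (fiber b) x' ->
    (vol (polar_at (Qpoly b) (B^T *m x)) <=
     vol (polar_at (Qpoly b) (B^T *m x')))%E.

(* The minimizer exists and is unique for b in [pos]; [0] is the default value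
   elsewhere. *)
Definition santalo_map (b : 'cV[R]_d) : 'cV[R]_n := xget 0 (is_santalo_point b).

Definition santalo_patchwork : set 'cV[R]_n := santalo_map @` pos.

Definition chamber (b : 'cV[R]_d) : set 'cV[R]_d :=
  \bigcap_(s in [set s : {set 'I_n} | cone (colsel s) b]) cone (colsel s).

Definition chamber_complex : set (set 'cV[R]_d) :=
  [set chamber b | b in cone A].

Definition cells : set (set 'cV[R]_d) :=
  chamber_complex `&` [set C | aff_dim C d].

Definition facet_indices (b : 'cV[R]_d) : {set 'I_n} :=
  finset (fun i => `[< is_facet (fiber b) (fiber b `&` [set x | x i 0 = 0]) >]).

Definition vertex_indices (b : 'cV[R]_d) (v : 'cV[R]_n) : {set 'I_n} :=
  finset (fun i => (i \in facet_indices b) && (v i 0 == 0)).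

(* The combinatorial type of the fiber over b is the same for all interior
   points b of a cell C; it is read off at an arbitrarily chosen one. *)
Definition cell_point (C : set 'cV[R]_d) : 'cV[R]_d := xget 0 C°.

Definition FC (C : set 'cV[R]_d) : {set 'I_n} := facet_indices (cell_point C).

Definition VC (C : set 'cV[R]_d) : {set {set 'I_n}} :=
  finset (fun I => `[< exists v, is_vertex (fiber (cell_point C)) v /\
                                 I = vertex_indices (cell_point C) v >]).

(* |det A_s|, for #|s| = d: [conform_mx] only casts 'M_(d, #|s|) to 'M_d, and
   the order of the columns is irrelevant for the absolute value. *)
Definition absdet (s : {set 'I_n}) : R :=
  `| \det (conform_mx (0 : 'M[R]_d) (colsel s)) |.

Definition alpha (C : set 'cV[R]_d) (x : 'cV[R]_n) : R :=
  \sum_(I in VC C) absdet (~: I)%SET * \prod_(i in (FC C :\: I)%SET) x i 0.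

Definition santalo_patch (C : set 'cV[R]_d) : set 'cV[R]_n :=
  [set x | [/\ @orthant_pos n x, (C `&` pos) (A *m x) &
     (rowsub (fun j : 'I_#|FC C| => enum_val j) B)^T *m
       (\col_(j < #|FC C|)
          ('D_(delta_mx (enum_val j) 0) (alpha C) x / alpha C x
           - (x (enum_val j) 0)^-1)) = 0]].

End Santalo.

(* Main.v *)
(* For a cell C, a point b of C and x in the relative interior of P_b, the
   polar of Q_b - B^T x is cut by the simplicial normal cones of a generic
   fiber P_p, p in int C, into simplices: in coordinates, the piece attached to
   the vertex set I is { lam >= 0 : sum_(i in I) lam_i x_i <= 1 }, and its
   volume is proportional to |det A_([n] - I)| / x_I.  Hence the volume of the
   polar is, up to a positive constant that depends neither on b nor on x, the
   function f(x) = sum_I |det A_([n] - I)| / x_I = alpha_C(x) / x_(F_C), also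
   for b on the boundary of C.  Each 1/x_I is log-convex, so f lies strictly
   above its tangent planes on a fiber; the minimiser of f is therefore its only
   critical point there, and the vanishing of the derivative of log f along
   ker A is the equation of the Santalo patch.  Continuity follows by
   compactness, since sublevel sets of f stay away from the boundary of the
   orthant.  Every b lies in a cell because a small generic perturbation of b
   lies in no cone A_sigma that does not contain b. *)

Require Import Defs.
From HB Require Import structures.
From mathcomp Require Import all_boot all_order all_algebra.
From mathcomp Require Import all_classical all_reals all_analysis.
From mathcomp Require Import perm measurable_realfun ring lra.

Set Implicit Arguments.
Unset Strict Implicit.
Unset Printing Implicit Defensive.

Import Order.TTheory GRing.Theory Num.Theory.
Import numFieldNormedType.Exports.

Local Open Scope classical_set_scope.
Local Open Scope ring_scope.

(** * Lebesgue volume and linear maps *)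

Section VectorMeasure.
Variable R : realType.
Implicit Types m : nat.

(** Over the boundary of [C] vertices of the fiber merge, yet each [I] in [VC A C] must keep its
    simplex and its weight. This works because the cone on the columns outside [I], which contains
    the chosen interior point, contains all of [C]. Hence every fiber over [C] has a point vanishing
    on [I], where the forms in the normal cone of [I] attain their maximum. That inclusion is not
    immediate: the chamber of [b] only controls the cones that contain [b], and an interior point
    could a priori lie in others; a linear programming argument rules this out. The determinants of
    [A] arise by duality: a piece has volume proportional to a maximal minor of [B], and
    complementary minors of [A] and [B] agree up to a common factor. A second obstacle is that
    [inv_weight] sees only the coordinates that occur in some [I]. Positivity of any other
    coordinate is recovered by writing it as a nonnegative number plus a nonnegative combination of
    visible coordinates. The inverse of the Santalo map on a patch is multiplication by [A], so the
    continuity at stake is that of the minimiser. *)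

Definition coord_preimages m : set (set 'cV[R]_m) :=
  [set X | exists (i : 'I_m) (Y : set (measurableTypeR R)),
     measurable Y /\ X = [set v : 'cV[R]_m | Y (v i 0)]].

Local Notation vec m := (g_sigma_algebraType (@coord_preimages m)).
Local Notation scl := (measurableTypeR R).
Local Notation mu1 := (@lebesgue_measure R).

Lemma measurable_coord m (i : 'I_m) :
  measurable_fun [set: vec m] (fun v => v i 0 : scl).
Proof.
move=> _ Y mY; rewrite setTI; apply: sub_sigma_algebra.
by exists i, Y.
Qed.

Lemma measurable_vec d (T : measurableType d) m (f : T -> vec m) :
  (forall i, measurable_fun setT (fun x => f x i 0 : scl)) ->
  measurable_fun setT f.
Proof.
move=> mf; apply: (@measurability _ _ T (vec m) setT f (@coord_preimages m)) => //.
move=> _ [_ [i [Y [mY ->]]] <-].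
exact: (mf i measurableT Y mY).
Qed.

Lemma measurable_lincomb d (T : measurableType d) m (f : 'I_m -> T -> scl)
    (a : 'I_m -> R) :
  (forall i, measurable_fun setT (f i)) ->
  measurable_fun setT (fun x => \sum_i a i * f i x : scl).
Proof.
move=> mf; apply: measurable_sum => i.
by apply: measurable_funM; [exact: (measurable_cst (a i : scl))|exact: mf].
Qed.

Lemma measurable_mulmx m k (L : 'M[R]_(k, m)) :
  measurable_fun [set: vec m] (fun v => L *m v : vec k).
Proof.
apply: measurable_vec => i.
rewrite (_ : (fun _ => _) = fun v : vec m => \sum_j L i j * v j 0); last first.
  by apply/funext => v; rewrite mxE.
by apply: measurable_lincomb => j; exact: measurable_coord.
Qed.

Lemma measurable_addl m (c : 'cV[R]_m) :
  measurable_fun [set: vec m] (fun v => c + v : vec m).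
Proof.
apply: measurable_vec => i.
rewrite (_ : (fun _ => _) = fun v : vec m => c i 0 + v i 0); last first.
  by apply/funext => v; rewrite mxE.
by apply: measurable_funD; [exact: (measurable_cst (c i 0 : scl))|exact: measurable_coord].
Qed.

Definition vcons m (p : scl * vec m) : vec m.+1 := col_mx (p.1%:M : 'cV[R]_1) p.2.
Definition vsplit m (v : vec m.+1) : scl * vec m :=
  (v 0 0, \col_i v (lift 0 i) 0).

Lemma vcons0 m (p : scl * vec m) : vcons p 0 0 = p.1.
Proof.
rewrite /vcons mxE; case: splitP => j /= jE; last by [].
by rewrite ord1 mxE eqxx mulr1n.
Qed.

Lemma vconsS m (p : scl * vec m) i : vcons p (lift 0 i) 0 = p.2 i 0.
Proof.
rewrite /vcons mxE; case: splitP => j /= jE; first by case: j jE => -[].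
by congr (p.2 _ 0); apply/val_inj; case: jE.
Qed.

Lemma vconsK m : cancel (@vcons m) (@vsplit m).
Proof.
move=> [t y]; rewrite /vsplit vcons0; congr pair.
by apply/matrixP => i j; rewrite mxE vconsS ord1.
Qed.

Lemma vsplitK m : cancel (@vsplit m) (@vcons m).
Proof.
move=> v; apply/matrixP => i j; rewrite ord1.
case: (unliftP 0 i) => [k ->|->]; first by rewrite vconsS mxE.
by rewrite vcons0.
Qed.

Lemma measurable_vcons m : measurable_fun setT (@vcons m).
Proof.
apply: measurable_vec => i; case: (unliftP 0 i) => [k ->|->].
  rewrite (_ : (fun _ => _) = (fun v : vec m => v k 0) \o snd); last first.
    by apply/funext => p; rewrite vconsS.
  by apply: measurableT_comp => //; exact: measurable_coord.
rewrite (_ : (fun _ => _) = fst) //.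
by apply/funext => p; rewrite vcons0.
Qed.

Lemma measurable_vsplit m : measurable_fun setT (@vsplit m).
Proof.
apply: measurable_fun_pair; first exact: measurable_coord.
apply: measurable_vec => i.
rewrite (_ : (fun _ => _) = fun v : vec m.+1 => v (lift 0 i) 0).
  exact: measurable_coord.
by apply/funext => v; rewrite mxE.
Qed.

Lemma preimage_measurable d1 d2 (T1 : measurableType d1) (T2 : measurableType d2)
  (f : T1 -> T2) S : measurable_fun setT f -> measurable S -> measurable (f @^-1` S).
Proof. by move=> mf mS; rewrite -[X in measurable X]setTI; exact: mf. Qed.

(** The recursive integral [vol] is not additive by construction. Agreement with a sigma-finite
    measure on measurable sets is what yields additivity, monotonicity and Fubini. *)
Definition represents_vol m (mu : {sigma_finite_measure set (vec m) -> \bar R}) :=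
  forall S : set (vec m), measurable S -> vol S = mu S.

Section Step.
Variables (m : nat) (mu : {sigma_finite_measure set (vec m) -> \bar R}).

Definition step_measure : set (vec m.+1) -> \bar R :=
  pushforward (mu1 \x mu)%E (@vcons m).

Let step0 : step_measure set0 = 0%E.
Proof. by rewrite /step_measure /pushforward preimage_set0 measure0. Qed.

Let step_ge0 A : (0 <= step_measure A)%E.
Proof. by rewrite /step_measure /pushforward measure_ge0. Qed.

Let step_additive : semi_sigma_additive step_measure.
Proof.
move=> F mF tF mUF; rewrite /step_measure /pushforward preimage_bigcup.
apply: measure_semi_sigma_additive.
- by move=> n; exact: preimage_measurable (@measurable_vcons m) (mF n).
- apply/trivIsetP => /= i j _ _ ij; rewrite -preimage_setI.
  by move/trivIsetP : tF => /(_ _ _ _ _ ij) ->//; rewrite preimage_set0.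
- by rewrite -preimage_bigcup; exact: preimage_measurable (@measurable_vcons m) mUF.
Qed.

HB.instance Definition _ := isMeasure.Build _ _ _ step_measure
  step0 step_ge0 step_additive.

Let step_sigma_finite : sigma_finite setT step_measure.
Proof.
have /sigma_finiteP[F [FT ndF Ffin]] := sigma_finiteT mu1.
have /sigma_finiteP[G [GT ndG Gfin]] := sigma_finiteT mu.
exists (fun k => @vsplit m @^-1` (F k `*` G k)).
  rewrite -preimage_bigcup; apply/seteqP; split => // v _ /=.
  have [i _ Fi] : (\bigcup_k F k) (vsplit v).1 by rewrite -FT.
  have [j _ Gj] : (\bigcup_k G k) (vsplit v).2 by rewrite -GT.
  exists (maxn i j) => //; split => /=.
    by move: Fi; exact/subsetPset/ndF/leq_maxl.
  by move: Gj; exact/subsetPset/ndG/leq_maxr.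
move=> k; have [mF Fk] := Ffin k; have [mG Gk] := Gfin k; split.
  exact: preimage_measurable (@measurable_vsplit m) (measurableX mF mG).
rewrite /step_measure /pushforward.
rewrite (_ : _ @^-1` _ = F k `*` G k); last first.
  by apply/seteqP; split => p; rewrite /preimage /mkset vconsK.
by rewrite product_measure1E// lte_mul_pinfty// ge0_fin_numE.
Qed.

HB.instance Definition _ := Measure_isSigmaFinite.Build _ _ _ step_measure
  step_sigma_finite.

Lemma step_represents : represents_vol mu -> represents_vol step_measure.
Proof.
move=> muE S mS; rewrite /step_measure /pushforward /product_measure1 /=.
apply: eq_integral => t _ /=; rewrite muE.
  by congr (mu _); apply/seteqP; split => y; rewrite /xsection /= inE.
have := measurable_xsection t (preimage_measurable (@measurable_vcons m) mS).
congr (measurable _).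
by apply/seteqP; split => y; rewrite /xsection /= inE.
Qed.
End Step.

Lemma vol_represented m :
  {mu : {sigma_finite_measure set (vec m) -> \bar R} | represents_vol mu}.
Proof.
elim: m => [|m [mu muE]]; last by exists (step_measure mu); exact: step_represents.
by exists (dirac (0 : vec 0)) => S mS /=; rewrite diracE indicE.
Qed.

Definition volm m := sval (vol_represented m).

Lemma volmE m (S : set (vec m)) : measurable S -> vol S = volm m S.
Proof. exact: (svalP (vol_represented m)). Qed.

End VectorMeasure.

Section VectorVolume.
Variable R : realType.
Implicit Types m : nat.

Local Notation vec m := (g_sigma_algebraType (@coord_preimages R m)).
Local Notation scl := (measurableTypeR R).
Local Notation mu1 := (@lebesgue_measure R).

Definition push_measure d1 d2 (T1 : measurableType d1) (T2 : measurableType d2)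
    (mu : {measure set T1 -> \bar R}) (f : T1 -> T2) (mf : measurable_fun setT f) :
  {measure set T2 -> \bar R}.
Proof.
by unshelve refine (pushforward mu f : {measure set T2 -> \bar R}).
Defined.

(** By uniqueness of Lebesgue measure it suffices to compare both sides on intervals []x, y]]. For
    negative [a] the preimage is half-open at the other end. *)
Lemma lebesgue_affine (a c : R) (X : set scl) : a != 0 -> measurable X ->
  (mu1 X = `|a|%:E * mu1 [set t | X (a * t + c)%R])%E.
Proof.
move=> a0 mX.
have mphi : measurable_fun setT (fun t : scl => a * t + c : scl).
  apply: measurable_funD; last exact: (measurable_cst (c : scl)).
  by apply: measurable_funM => //; exact: (measurable_cst (a : scl)).
have na0 : 0 < `|a| by rewrite normr_gt0.
pose nu := mscale (NngNum (normr_ge0 a)) (push_measure mu1 mphi).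
rewrite [LHS](@lebesgue_measure_unique R nu) //.
move=> _ [[x y]] _ <-.
rewrite lebesgue_measure_itv /= lte_fin.
have preE : [set t : scl | `]x, y]%classic (a * t + c)%R] =
    (if 0 < a then `](x - c) / a, (y - c) / a]%classic
  else `[(y - c) / a, (x - c) / a[%classic).
  apply/seteqP; split => t /=; case: ifPn => sa /=; rewrite !in_itv /=.
  - by rewrite ltr_pdivrMr // ler_pdivlMr // ltrBlDr lerBrDr ![t * a]mulrC.
  - have {}sa : a < 0 by rewrite lt_neqAle a0 leNgt.
    by rewrite ltr_ndivlMr // ler_ndivrMr // ltrBlDr lerBrDr ![t * a]mulrC andbC.
  - by rewrite ltr_pdivrMr // ler_pdivlMr // ltrBlDr lerBrDr ![t * a]mulrC.
  - have {}sa : a < 0 by rewrite lt_neqAle a0 leNgt.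
    by rewrite ltr_ndivlMr // ler_ndivrMr // ltrBlDr lerBrDr ![t * a]mulrC andbC.
set J := (X in _ = X) in preE.
transitivity (`|a|%:E * mu1 J)%E; last by rewrite -preE.
rewrite /J {J preE}.
have [sa|sa] := ltrP 0 a; rewrite lebesgue_measure_itv /= lte_fin.
  rewrite ltr_pM2r ?invr_gt0// ltrD2r; case: ifPn => // xy; last by rewrite mule0.
  rewrite -!EFinD -EFinM gtr0_norm //; congr (_%:E); by field.
have {}sa : a < 0 by rewrite lt_neqAle a0.
rewrite ltr_nM2r ?invr_lt0// ltrD2r; case: ifPn => // xy; last by rewrite mule0.
rewrite -!EFinD -EFinM ltr0_norm //; congr (_%:E); by field.
Qed.

Lemma integral_affine (a c : R) (F : scl -> \bar R) : a != 0 ->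
  measurable_fun setT F -> (forall t, 0 <= F t)%E ->
  (\int[mu1]_t F t = `|a|%:E * \int[mu1]_t F (a * t + c)%R)%E.
Proof.
move=> a0 mF F0.
have mphi : measurable_fun setT (fun t : scl => a * t + c : scl).
  apply: measurable_funD; last exact: (measurable_cst (c : scl)).
  by apply: measurable_funM => //; exact: (measurable_cst (a : scl)).
pose nu := push_measure mu1 mphi.
rewrite (eq_measure_integral (mscale (NngNum (normr_ge0 a)) nu)); last first.
  by move=> X mX _; exact: lebesgue_affine.
rewrite ge0_integral_mscale //=; congr (_ * _)%E.
by rewrite /nu /push_measure ge0_integral_pushforward.
Qed.

Lemma vol_ge0 m (S : set (vec m)) : (0 <= vol S)%E.
Proof.
elim: m S => [|m IH] S; first by rewrite /= lee_fin indicE.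
by apply: integral_ge0 => t _; exact: IH.
Qed.

Definition vsection m (S : set (vec m.+1)) (t : scl) : set (vec m) :=
  [set y | S (vcons (t, y))].

Lemma volS m (S : set (vec m.+1)) : vol S = (\int[mu1]_t vol (vsection S t))%E.
Proof. by []. Qed.

Lemma measurable_vsection m (S : set (vec m.+1)) t :
  measurable S -> measurable (vsection S t).
Proof.
move=> mS.
have := measurable_xsection t (preimage_measurable (@measurable_vcons R m) mS).
congr (measurable _).
by apply/seteqP; split => y; rewrite /xsection /= inE.
Qed.

Lemma measurable_vol_vsection m (S : set (vec m.+1)) :
  measurable S -> measurable_fun setT (fun t => vol (vsection S t)).
Proof.
move=> mS.
rewrite (_ : (fun _ => _) = volm R m \o xsection (@vcons R m @^-1` S)).
  exact: measurable_fun_xsection (preimage_measurable (@measurable_vcons R m) mS).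
apply/funext => t /=; rewrite volmE; last exact: measurable_vsection.
by congr (volm R m _); apply/seteqP; split => y; rewrite /xsection /= inE.
Qed.

(** [vol] integrates over the first coordinate last. In the opposite order a shear of the first
    coordinate becomes a translation of each section. *)
Lemma vol_fubini m (S : set (vec m.+1)) : measurable S ->
  vol S = (\int[volm R m]_y mu1 [set t | S (vcons (t, y))])%E.
Proof.
move=> mS.
have mS' := preimage_measurable (@measurable_vcons R m) mS.
rewrite volS.
transitivity ((mu1 \x volm R m) (@vcons R m @^-1` S))%E.
  apply: eq_integral => t _ /=; rewrite volmE; last exact: measurable_vsection.
  by congr (volm R m _); apply/seteqP; split => y; rewrite /xsection /= inE.
rewrite (product_measure_unique (m' := (mu1 \x^ volm R m)%E)) //.
  apply: eq_integral => y _ /=; congr (mu1 _).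
  by apply/seteqP; split => t; rewrite /ysection /= inE.
by move=> X Y mX mY; exact: product_measure2E.
Qed.

Lemma vol_transl m (S : set (vec m)) (c : 'cV[R]_m) : measurable S ->
  vol [set v | S (c + v)] = vol S.
Proof.
elim: m S c => [|m IH] S c mS.
  by rewrite /= (_ : [set v | _] = S) //; apply/seteqP; split => v /=;
    rewrite (_ : c + v = v) //; apply/matrixP => -[].
have vconsD t y : c + vcons (t, y) = vcons (c 0 0 + t, (vsplit c).2 + y).
  rewrite -[LHS]vsplitK; congr vcons; rewrite /vsplit /= mxE vcons0; congr pair.
  by apply/matrixP => i j; rewrite ord1 [LHS]mxE [LHS]mxE vconsS [RHS]mxE [in RHS]mxE.
rewrite !volS.
transitivity (\int[mu1]_t vol (vsection S (c 0 0 + t)%R))%E.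
  apply: eq_integral => t _.
  rewrite -[RHS](IH _ (vsplit c).2); last exact: measurable_vsection.
  by congr vol; apply/seteqP; split => y; rewrite /vsection /mkset vconsD.
rewrite [RHS](@integral_affine 1 (c 0 0)) ?oner_eq0 //.
- by rewrite normr1 mul1e; apply: eq_integral => t _; rewrite mul1r addrC.
- exact: measurable_vol_vsection.
- by move=> t; exact: vol_ge0.
Qed.

(** Phrased with preimages, whose measurability is immediate and which compose well under products
    of matrices. *)
Definition scales_vol m (L : 'M[R]_m) := forall S : set (vec m), measurable S ->
  vol S = (`|\det L|%:E * vol [set v | S (L *m v)])%E.

Lemma scales_volM m (L M : 'M[R]_m) :
  scales_vol L -> scales_vol M -> scales_vol (L *m M).
Proof.
move=> sL sM S mS; rewrite sL // (sM [set v | S (L *m v)]); last first.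
  exact: preimage_measurable (measurable_mulmx L) mS.
rewrite det_mulmx normrM EFinM muleA; congr (_ * vol _)%E.
by apply/seteqP; split => v /=; rewrite mulmxA.
Qed.

End VectorVolume.

(** * Change of variables for invertible matrices *)

Section LinearScaling.
Variable R : realType.
Implicit Types m : nat.

Local Notation vec m := (g_sigma_algebraType (@coord_preimages R m)).
Local Notation scl := (measurableTypeR R).
Local Notation mu1 := (@lebesgue_measure R).

Definition lower_mx m (l : R) (c : 'cV[R]_m) (D : 'M[R]_m) : 'M[R]_m.+1 :=
  block_mx (l%:M : 'M[R]_1) 0 c D.

Definition shear_mx m (w : 'rV[R]_m) : 'M[R]_m.+1 :=
  block_mx (1%:M : 'M[R]_1) w 0 1%:M.

Lemma lower_mx_vcons m l c D t (y : 'cV[R]_m) :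
  lower_mx l c D *m vcons (t, y) = vcons (l * t, t *: c + D *m y).
Proof.
rewrite /lower_mx /vcons /=.
rewrite [LHS](mul_block_col (l%:M : 'M[R]_1) 0 c D) mul0mx addr0.
by rewrite -scalar_mxM mul_mx_scalar.
Qed.

Lemma shear_mx_vcons m (w : 'rV[R]_m) t (y : 'cV[R]_m) :
  shear_mx w *m vcons (t, y) = vcons (t + (w *m y) 0 0, y).
Proof.
rewrite /shear_mx /vcons /=.
rewrite [LHS](mul_block_col (1%:M : 'M[R]_1) w 0 1%:M) mul0mx add0r !mul1mx.
by rewrite raddfD /= -[in RHS]mx11_scalar.
Qed.

Lemma shear_mx_lift m (w : 'rV[R]_m) k : shear_mx w 0 (lift 0 k) = w 0 k.
Proof.
rewrite /shear_mx mxE; case: splitP => i //= iE.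
rewrite mxE; case: splitP => j /= jE; first by case: j jE => -[].
by rewrite ord1; congr (w 0 _); apply/val_inj; case: jE.
Qed.

Lemma det_lower_mx m l c (D : 'M[R]_m) : \det (lower_mx l c D) = l * \det D.
Proof. by rewrite /lower_mx (det_lblock (l%:M : 'M[R]_1) c D) det_scalar expr1. Qed.

Lemma det_shear_mx m (w : 'rV[R]_m) : \det (shear_mx w) = 1.
Proof. by rewrite /shear_mx (det_ublock (1%:M : 'M[R]_1) w 1%:M) !det1 mulr1. Qed.

Lemma scales_vol_shear m (w : 'rV[R]_m) : scales_vol (shear_mx w).
Proof.
move=> S mS; rewrite det_shear_mx normr1 mul1e.
have mLS := preimage_measurable (measurable_mulmx (shear_mx w)) mS.
rewrite vol_fubini // [RHS](vol_fubini mLS); apply: eq_integral => y _.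
have mSy : measurable [set t : scl | S (vcons (t, y))].
  have := measurable_ysection y (preimage_measurable (@measurable_vcons R m) mS).
  congr (measurable _).
  by apply/seteqP; split => t; rewrite /ysection /= inE.
rewrite (lebesgue_affine ((w *m y) 0 0) (oner_neq0 R) mSy) normr1 mul1e.
congr (mu1 _); apply/funext => t.
have E : S (vcons (1 * t + (w *m y) 0 0, y)) = S (shear_mx w *m vcons (t, y)).
  by rewrite shear_mx_vcons mul1r.
exact: E.
Qed.

(** The section of the preimage at [t] is the preimage under [D] of the section of [S] at [l * t],
    translated by [t *: c]. *)
Lemma scales_vol_lower m l c (D : 'M[R]_m) :
  l != 0 -> scales_vol D -> scales_vol (lower_mx l c D).
Proof.
move=> l0 sD S mS; rewrite det_lower_mx.
have mLS := preimage_measurable (measurable_mulmx (lower_mx l c D)) mS.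
rewrite volS (integral_affine 0 l0); last 2 first.
- exact: measurable_vol_vsection.
- by move=> t; exact: vol_ge0.
rewrite normrM EFinM -muleA; congr (_ * _)%E.
rewrite [in RHS]volS -ge0_integralZl //; last 2 first.
- exact: measurable_vol_vsection mLS.
- by move=> t _; exact: vol_ge0.
apply: eq_integral => t _; rewrite addr0.
have mSt := measurable_vsection (l * t) mS.
rewrite -(vol_transl (t *: c) mSt) sD; last first.
  exact: preimage_measurable (measurable_addl (t *: c)) mSt.
congr (_ * vol _)%E; apply/funext => y.
have E : S (vcons (l * t, t *: c + D *m y)) = S (lower_mx l c D *m vcons (t, y)).
  by rewrite lower_mx_vcons.
exact: E.
Qed.

Lemma scales_vol_pivot m (L : 'M[R]_m.+1) :
  (forall D : 'M[R]_m, D \in unitmx -> scales_vol D) ->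
  L 0 0 != 0 -> L \in unitmx -> scales_vol L.
Proof.
move=> IH a0 Lu.
pose L' : 'M[R]_(1 + m) := L; pose a := L 0 0.
pose c := dlsubmx L'; pose w := ursubmx L'; pose D := drsubmx L'.
(* Block elimination with pivot [a]: the lower right block is the Schur complement. *)
have LE : L = lower_mx a c (D - c *m (a^-1 *: w)) *m shear_mx (a^-1 *: w).
  rewrite /lower_mx /shear_mx.
  rewrite [RHS](mulmx_block (a%:M : 'M[R]_1) 0 c _ 1%:M (a^-1 *: w) 0 1%:M).
  rewrite !(mulmx0, mulmx1, mul0mx, addr0) [c *m _ + _]addrC subrK.
  rewrite mul_scalar_mx scalerA divff // scale1r -[LHS](submxK L') -/c -/w -/D.
  have -> // : ulsubmx L' = a%:M.
  rewrite [LHS]mx11_scalar; congr (_%:M); rewrite !mxE.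
  by congr (L _ _); exact/val_inj.
rewrite LE; apply: scales_volM; last exact: scales_vol_shear.
apply: scales_vol_lower => //; apply: IH.
move: Lu; rewrite !unitmxE LE det_mulmx det_shear_mx det_lower_mx mulr1 unitrM.
by case/andP.
Qed.

(* Block elimination: a matrix with nonzero pivot is a lower block matrix times
   a shear, and if the pivot vanishes a shear on the left makes it nonzero. *)
Theorem vol_linear m (L : 'M[R]_m) : L \in unitmx -> scales_vol L.
Proof.
elim: m L => [|m IH] L Lu.
  move=> S mS; rewrite det_mx00 normr1 mul1e; congr vol.
  by apply/seteqP; split => v /=; rewrite (_ : L *m v = v) //;
    apply/matrixP => -[].
have [a0|a0] := eqVneq (L 0 0) 0; last exact: scales_vol_pivot.
have [i ci] : exists i, L (lift 0 i) 0 != 0.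
  apply/existsP; apply: contraT; rewrite negb_exists => /forallP c0.
  move: Lu; rewrite unitmxE (expand_det_col _ 0) big1 ?unitr0// => j _.
  case: (unliftP 0 j) => [k ->|->]; last by rewrite a0 mul0r.
  by have /negPn/eqP -> := c0 k; rewrite mul0r.
pose w : 'rV[R]_m := delta_mx 0 i.
have shearK : shear_mx (- w) *m shear_mx w = 1%:M.
  rewrite /shear_mx.
  rewrite [LHS](mulmx_block (1%:M : 'M[R]_1) (- w) 0 1%:M 1%:M w 0 1%:M).
  by rewrite !(mulmx0, mulmx1, mul0mx, mul1mx, addr0, add0r) subrr -scalar_mx_block.
rewrite -[L]mul1mx -shearK -mulmxA; apply: scales_volM.
  exact: scales_vol_shear.
apply: scales_vol_pivot => //; last first.
  by rewrite unitmx_mul Lu andbT unitmxE det_shear_mx unitr1.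
rewrite mxE big_ord_recl a0 mulr0 add0r (bigD1 i) //= big1 ?addr0 => [|j ji].
  by rewrite shear_mx_lift mxE !eqxx mul1r.
by rewrite shear_mx_lift mxE (negPf ji) andbF mul0r.
Qed.
End LinearScaling.

(** * Volume of a union of simplices with a common apex *)

Section Simplex.
Variable R : realType.
Implicit Types m : nat.

Local Notation vec m := (g_sigma_algebraType (@coord_preimages R m)).
Local Notation scl := (measurableTypeR R).
Local Notation mu1 := (@lebesgue_measure R).

Definition std_simplex m : set (vec m) :=
  [set v | (forall i, 0 <= v i 0) /\ \sum_i v i 0 <= 1].

(** Only the coordinate faces are removed, since these are where neighbouring simplices meet; the
    outer face stays. *)
Definition open_simplex m : set (vec m) :=
  [set v | (forall i, 0 < v i 0) /\ \sum_i v i 0 <= 1].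

Definition box m (a : R) : set (vec m) := [set v | forall i, 0 <= v i 0 <= a].

Definition coord_hyperplanes m : set (vec m) := [set v | exists i, v i 0 = 0].

Lemma measurable_forall d (T : measurableType d) (I : finType) (F : I -> set T) :
  (forall i, measurable (F i)) -> measurable [set x | forall i, F i x].
Proof.
move=> mF; rewrite (_ : [set x | _] = \bigcap_(i in setT) F i); last first.
  by apply/seteqP; split => x /= Fx i //; exact: Fx.
by apply: fin_bigcap_measurable => //; exact: finite_finset.
Qed.

Lemma measurable_coord_set m (i : 'I_m) (Y : set scl) :
  measurable Y -> measurable [set v : vec m | Y (v i 0)].
Proof. exact: preimage_measurable (measurable_coord i). Qed.

Lemma measurable_sum_le1 m : measurable [set v : vec m | \sum_i v i 0 <= 1].
Proof.
have mf : measurable_fun setT (fun v : vec m => \sum_i v i 0 : scl).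
  by apply: measurable_sum => i; exact: measurable_coord.
rewrite (_ : [set v | _] = (fun v : vec m => \sum_i v i 0 : scl) @^-1` `]-oo, 1]).
  by apply: preimage_measurable mf _; exact: measurable_itv.
by apply/seteqP; split => v /=; rewrite in_itv.
Qed.

Lemma measurable_std_simplex m : measurable (@std_simplex m).
Proof.
rewrite (_ : @std_simplex m = [set v | forall i, 0 <= v i 0] `&`
  [set v | \sum_i v i 0 <= 1]) //.
apply: measurableI; last exact: measurable_sum_le1.
apply: (@measurable_forall _ (vec m) _ (fun i => [set v | 0 <= v i 0])) => i.
have := @measurable_coord_set m i `[0, +oo[ (measurable_itv _).
by congr measurable; apply/seteqP; split => v /=; rewrite in_itv /= andbT.
Qed.

Lemma measurable_open_simplex m : measurable (@open_simplex m).
Proof.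
rewrite (_ : @open_simplex m = [set v | forall i, 0 < v i 0] `&`
  [set v | \sum_i v i 0 <= 1]) //.
apply: measurableI; last exact: measurable_sum_le1.
apply: (@measurable_forall _ (vec m) _ (fun i => [set v | 0 < v i 0])) => i.
have := @measurable_coord_set m i `]0, +oo[ (measurable_itv _).
by congr measurable; apply/seteqP; split => v /=; rewrite in_itv /= andbT.
Qed.

Lemma measurable_box m a : measurable (@box m a).
Proof.
apply: (@measurable_forall _ (vec m) _ (fun i => [set v | 0 <= v i 0 <= a])) => i.
have := @measurable_coord_set m i `[0, a] (measurable_itv _).
by congr measurable; apply/seteqP; split => v /=; rewrite in_itv.
Qed.

Lemma measurable_coord_hyperplane m i : measurable [set v : vec m | v i 0 = 0].
Proof. by apply: (@measurable_coord_set m i [set 0]); exact: measurable_set1. Qed.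

Lemma vol_box m a : 0 <= a -> vol (@box m a) = (a ^+ m)%:E.
Proof.
move=> a0; elim: m => [|m IH].
  by rewrite /= indicE expr0 mem_set // => -[].
rewrite volS.
transitivity (\int[mu1]_t ((\1_(`[0, a] : set scl) t)%:E * (a ^+ m)%:E))%E.
  apply: eq_integral => t _; rewrite indicE.
  have vE : vsection (@box m.+1 a) t = if t \in `[0, a] then @box m a else set0.
    apply/seteqP; split => y.
      move=> yb; have := yb 0; rewrite vcons0 /= => ta.
      by rewrite in_itv /= ta => i; have := yb (lift 0 i); rewrite vconsS.
    case: ifPn => // ta yb i; case: (unliftP 0 i) => [k ->|->].
      by rewrite vconsS; exact: yb.
    by rewrite vcons0; move: ta; rewrite in_itv.
  rewrite vE; have [ta|ta] := boolP (t \in `[0, a]).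
    by rewrite mem_set // mul1e.
  rewrite memNset ?mul0e; last exact/negP.
  by rewrite volmE // measure0.
rewrite ge0_integralZr //=; last 2 first.
- exact: measurableT_comp.
- by rewrite lee_fin exprn_ge0.
rewrite integral_indic //= setIT lebesgue_measure_itv /= lte_fin.
case: ltrP => [a'|a']; first by rewrite sube0 -EFinM exprS.
by rewrite mul0e exprS (_ : a = 0) ?mul0r //; apply/eqP; rewrite eq_le a' a0.
Qed.

Lemma vol_coord_hyperplane m i : vol [set v : vec m | v i 0 = 0] = 0%E.
Proof.
elim: m i => [[]//|m IH] i.
case: (unliftP 0 i) => [k ->|->].
  rewrite volS integral0_eq // => t _.
  rewrite -[RHS](IH k); congr vol; apply/seteqP; split => y;
    by rewrite /vsection /mkset vconsS.
rewrite vol_fubini; last exact: measurable_coord_hyperplane.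
rewrite integral0_eq // => y _.
rewrite (_ : [set t | _] = [set 0 : scl]) ?lebesgue_measure_set1 //.
by apply/seteqP; split => t; rewrite /mkset vcons0.
Qed.

Lemma vol_coord_hyperplanes m : volm R m (@coord_hyperplanes m) = 0%E.
Proof.
have E : @coord_hyperplanes m = \bigcup_(i in setT) [set v : vec m | v i 0 = 0].
  by apply/seteqP; split => v /= [i]; [exists i|move=> _; exists i].
have mH i : measurable [set v : vec m | v i 0 = 0] by exact: measurable_coord_hyperplane.
have := content_sub_fsum (volm R m) (finite_finset (X := [set: 'I_m])) (fun i _ => mH i)
  (fin_bigcup_measurable finite_finset (fun i _ => mH i)) (@subset_refl _ _).
rewrite -E => H; apply/eqP; rewrite -measure_le0; apply: le_trans H _.
rewrite fsbig1 // => i _.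
exact: etrans (esym (volmE (mH i))) (vol_coord_hyperplane i).
Qed.

Lemma le_volm m (S T : set (vec m)) : measurable S -> measurable T ->
  S `<=` T -> (volm R m S <= volm R m T)%E.
Proof. by move=> mS mT ST; apply: le_measure => //; rewrite inE. Qed.

Lemma vol_open_simplex m : volm R m (@open_simplex m) = volm R m (@std_simplex m).
Proof.
have mH : measurable (@coord_hyperplanes m).
  rewrite (_ : @coord_hyperplanes m = \bigcup_(i in setT) [set v : vec m | v i 0 = 0]).
    apply: fin_bigcup_measurable; first exact: finite_finset.
    by move=> i _; exact: measurable_coord_hyperplane.
  by apply/seteqP; split => v /= [i]; [exists i|move=> _; exists i].
apply/eqP; rewrite eq_le; apply/andP; split.
  apply: le_volm; [exact: measurable_open_simplex|exact: measurable_std_simplex|].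
  by move=> v [v0 v1]; split => // i; exact: ltW.
rewrite -[leRHS]adde0 -(vol_coord_hyperplanes m).
apply: le_trans (measureU2 (volm R m) (@measurable_open_simplex m) mH).
apply: le_volm; [exact: measurable_std_simplex| |].
  by apply: measurableU => //; exact: measurable_open_simplex.
move=> v [v0 v1]; have [h|h] := pselect (exists i, v i 0 = 0); [by right|left].
split => // i; rewrite lt_neqAle v0 andbT eq_sym; apply/eqP => vi0.
by apply: h; exists i.
Qed.

(** [fine] loses nothing: the simplex lies between the cubes of side [m.+1%:R^-1] and 1, so its
    volume is finite and positive. Taking m + 1 instead of m covers dimension 0. *)
Definition simplex_vol m : R := fine (volm R m (@std_simplex m)).

Lemma box_sub_simplex m : @box m (m.+1%:R^-1) `<=` @std_simplex m.
Proof.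
move=> v vb; split => [i|]; first by case/andP: (vb i).
apply: (@le_trans _ _ (\sum_(i < m) m.+1%:R^-1)).
  by apply: ler_sum => i _; case/andP: (vb i).
rewrite sumr_const card_ord -[leLHS]mulr_natr mulrC ler_pdivrMr ?ltr0n // mul1r ler_nat.
exact: leqnSn.
Qed.

Lemma simplex_sub_box m : @std_simplex m `<=` @box m 1.
Proof.
move=> v [v0 v1] i; rewrite v0 /=; apply: le_trans v1.
by rewrite (bigD1 i) //= lerDl sumr_ge0.
Qed.

Lemma simplex_volE m : volm R m (@std_simplex m) = (simplex_vol m)%:E.
Proof.
rewrite /simplex_vol fineK // ge0_fin_numE //.
have := le_volm (@measurable_std_simplex m) (@measurable_box m 1) (@simplex_sub_box m).
move=> /le_lt_trans; apply; rewrite -volmE; last exact: measurable_box.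
by rewrite vol_box // ltry.
Qed.

Lemma simplex_vol_gt0 m : 0 < simplex_vol m.
Proof.
rewrite -lte_fin -simplex_volE.
have := le_volm (@measurable_box m _) (@measurable_std_simplex m) (@box_sub_simplex m).
apply: lt_le_trans; rewrite -volmE; last exact: measurable_box.
by rewrite vol_box ?invr_ge0 ?ler0n // lte_fin exprn_gt0 // invr_gt0 ltr0n.
Qed.

Lemma vol_linear_preimage m (S : set (vec m)) (M : 'M[R]_m) s :
  measurable S -> M \in unitmx -> volm R m S = s%:E ->
  volm R m [set z | S (M *m z)] = (s / `|\det M|)%:E.
Proof.
move=> mS Mu Ss; have := vol_linear Mu mS.
have mS' : measurable [set z : vec m | S (M *m z)].
  exact: preimage_measurable (measurable_mulmx M) mS.
rewrite !volmE // Ss.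
have d0 : 0 < `|\det M| by rewrite normr_gt0 -unitfE -unitmxE.
case: (volm R m _) => [r||].
- by rewrite -EFinM => -[->]; rewrite [X in X / _]mulrC mulfK // gt_eqF.
- by rewrite gt0_muley.
- by rewrite gt0_muleNy.
Qed.

(* The pieces overlap only in images of coordinate hyperplanes. *)
Lemma vol_simplicial_union m (J : finType) (P : {pred J}) (M : J -> 'M[R]_m)
    (D : set 'cV[R]_m) :
  (forall j, P j -> M j \in unitmx) ->
  (forall z, D z <-> exists2 j, P j & std_simplex (M j *m z)) ->
  (forall i j z, P i -> P j ->
     open_simplex (M i *m z) -> open_simplex (M j *m z) -> i = j) ->
  vol D = (simplex_vol m * \sum_(j | P j) `|\det (M j)|^-1)%:E.
Proof.
move=> Mu DE disj.
pose F j := [set z : vec m | std_simplex (M j *m z)].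
pose G j := [set z : vec m | open_simplex (M j *m z)].
have mF j : measurable (F j).
  exact: preimage_measurable (measurable_mulmx (M j)) (@measurable_std_simplex m).
have mG j : measurable (G j).
  exact: preimage_measurable (measurable_mulmx (M j)) (@measurable_open_simplex m).
have mE : D = \bigcup_(j in [set` P]) F j.
  by apply/seteqP; split => z => [/DE[j]|[j Pj Fj]]; [exists j|apply/DE; exists j].
have mD : measurable (D : set (vec m)).
  by rewrite mE; apply: fin_bigcup_measurable => //; exact: finite_finset.
rewrite volmE //.
have sumE : (simplex_vol m * \sum_(j | P j) `|\det (M j)|^-1)%:E =
    (\sum_(j \in [set` P]) (simplex_vol m / `|\det (M j)|)%:E)%E.
  have -> : [set` P] = [set` enum P].
    by apply/seteqP; split => j /=; rewrite mem_enum.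
  by rewrite mulr_sumr -sumEFin -big_enum /= fsbig_seq ?enum_uniq.
rewrite sumE; apply/eqP; rewrite eq_le; apply/andP; split.
  have DF : D `<=` \bigcup_(j in [set` P]) F j by rewrite mE.
  apply: le_trans (content_sub_fsum (volm R m) (finite_finset (X := [set` P]))
    (fun j _ => mF j) mD DF) _.
  apply: lee_fsum => [|j Pj]; first exact: finite_finset.
  rewrite le_eqVlt; apply/orP; left; apply/eqP.
  exact: vol_linear_preimage (@measurable_std_simplex m) (Mu j Pj) (simplex_volE m).
(* Lower bound: the [G j] are disjoint and have the same measures as the [F j]. *)
have -> : (\sum_(j \in [set` P]) (simplex_vol m / `|\det (M j)|)%:E =
    \sum_(j \in [set` P]) volm R m (G j))%E.
  apply: eq_fsbigr => j /set_mem Pj.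
  apply/esym/vol_linear_preimage; [exact: measurable_open_simplex|exact: Mu|].
  by rewrite vol_open_simplex simplex_volE.
have trivG : trivIset [set` P] G.
  by move=> i j Pi Pj [z [Gi Gj]]; exact: disj Gi Gj.
rewrite -(measure_fin_bigcup (volm R m) (finite_finset (X := [set` P])) trivG) //.
apply: le_volm => //.
  by apply: fin_bigcup_measurable => //; exact: finite_finset.
rewrite mE => z [j Pj [z0 z1]]; exists j => //; split => // i.
exact: ltW.
Qed.

End Simplex.

(** * Topology of column vectors *)

Section ColumnTopology.
Variable R : realType.

Lemma cvg_mx (T : Type) (F : set_system T) (FF : Filter F) p q
    (f : T -> 'M[R]_(p, q)) (l : 'M[R]_(p, q)) :
  (forall i j, (fun x => f x i j) @ F --> l i j) -> f @ F --> l.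
Proof.
move=> fl S [P lP PS].
have : \forall x \near F, forall ij : 'I_p * 'I_q, P ij.1 ij.2 (f x ij.1 ij.2).
  by apply: filter_forall => -[i j]; exact: fl (lP i j).
by apply: filterS => x Px; apply: PS => i j; exact: (Px (i, j)).
Qed.

Lemma coord_cvg (T : Type) (F : set_system T) (FF : Filter F) p q
    (f : T -> 'M[R]_(p, q)) (l : 'M[R]_(p, q)) i j :
  f @ F --> l -> (fun x => f x i j) @ F --> l i j.
Proof.
move=> fl; apply: (cvg_comp f (fun M : 'M[R]_(p, q) => M i j) fl).
exact: (@coord_continuous R p q i j l).
Qed.

Lemma cvg_sum (T : Type) (F : set_system T) (FF : Filter F) (I : Type) (r : seq I)
    (P : pred I) (f : I -> T -> R) (l : I -> R) :
  (forall i, P i -> f i @ F --> l i) ->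
  (fun x => \sum_(i <- r | P i) f i x) @ F --> \sum_(i <- r | P i) l i.
Proof. by move=> fl; apply: cvg_big => //; exact: add_continuous. Qed.

Lemma cvg_prod (T : Type) (F : set_system T) (FF : Filter F) (I : Type) (r : seq I)
    (P : pred I) (f : I -> T -> R) (l : I -> R) :
  (forall i, P i -> f i @ F --> l i) ->
  (fun x => \prod_(i <- r | P i) f i x) @ F --> \prod_(i <- r | P i) l i.
Proof. by move=> fl; apply: cvg_big => //; exact: mul_continuous. Qed.

Lemma cvg_mulmx (T : Type) (F : set_system T) (FF : Filter F) p q s
    (M : 'M[R]_(p, q)) (f : T -> 'M[R]_(q, s)) (l : 'M[R]_(q, s)) :
  f @ F --> l -> (fun x => M *m f x) @ F --> M *m l.
Proof.
move=> fl; apply: cvg_mx => i j; rewrite mxE.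
rewrite (_ : (fun x => _) = fun x => \sum_k M i k * f x k j); last first.
  by apply/funext => x; rewrite mxE.
apply: cvg_sum => k _; apply: cvgM; first exact: cvg_cst.
exact: coord_cvg.
Qed.

Lemma mulmx_continuous p q s (M : 'M[R]_(p, q)) :
  continuous (fun x : 'M[R]_(q, s) => M *m x).
Proof. by move=> x; apply: (@cvg_mulmx _ (nbhs x) _ p q s M id x); exact: cvg_id. Qed.

Lemma trmx_continuous p q : continuous (@trmx R p q).
Proof.
move=> x; apply: (@cvg_mx _ (nbhs x) _ _ _ (@trmx R p q)) => i j; rewrite mxE.
rewrite (_ : (fun y => _) = fun y : 'M[R]_(p, q) => y j i); last first.
  by apply/funext => y; rewrite mxE.
exact: coord_continuous.
Qed.

Lemma near_orthant_pos m (x : 'cV[R]_m) : orthant_pos x ->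
  \forall y \near x, orthant_pos y.
Proof.
move=> x0; apply: (@filter_forall _ _ (fun i (y : 'cV[R]_m) => 0 < y i 0) (nbhs x)) => i.
by apply: (cvgr_gt (x i 0)) (x0 i); exact: coord_continuous.
Qed.

Lemma closed_preimage (T U : topologicalType) (f : T -> U) (D : set U) :
  continuous f -> closed D -> closed [set x | D (f x)].
Proof. by move=> cf cD; apply: preimage_closed => // x _; exact: cf. Qed.

Lemma closed_forall (T : topologicalType) (I : Type) (P : I -> set T) :
  (forall i, closed (P i)) -> closed [set x | forall i, P i x].
Proof.
move=> cP; rewrite (_ : [set x | _] = \bigcap_(i in setT) P i).
  by apply: closed_bigI => i _.
by apply/seteqP; split => x Px i; [move=> _; exact: Px|exact: Px].
Qed.

Lemma closed_coord_ge m (i : 'I_m) (c : R) : closed [set x : 'cV[R]_m | c <= x i 0].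
Proof.
exact: (@closed_preimage _ _ _ [set t : R | c <= t]
  (@coord_continuous R m 1 i 0) (@closed_ge R c)).
Qed.

Lemma closed_coord_le m (i : 'I_m) (c : R) : closed [set x : 'cV[R]_m | x i 0 <= c].
Proof.
exact: (@closed_preimage _ _ _ [set t : R | t <= c]
  (@coord_continuous R m 1 i 0) (@closed_le R c)).
Qed.

Lemma closed_coord_eq m (i : 'I_m) (c : R) : closed [set x : 'cV[R]_m | x i 0 = c].
Proof.
exact: (@closed_preimage _ _ _ [set t : R | t = c]
  (@coord_continuous R m 1 i 0) (@closed_eq R c)).
Qed.

Lemma closed_mulmx_eq p q (M : 'M[R]_(p, q)) (b : 'cV[R]_p) :
  closed [set x : 'cV[R]_q | M *m x = b].
Proof.
rewrite (_ : [set x | _] = [set x : 'cV[R]_q | forall i, (M *m x) i 0 = b i 0]).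
  apply: closed_forall => i.
  exact: (closed_preimage (@mulmx_continuous p q 1 M) (@closed_coord_eq p i (b i 0))).
by apply/seteqP; split => x /= h; [rewrite h|apply/matrixP => i j; rewrite ord1].
Qed.

Lemma cV_compact m (S : set 'cV[R]_m) (K : R) : closed S ->
  (forall x, S x -> forall i, `|x i 0| <= K) -> compact S.
Proof.
move=> cS bS.
have cT : compact [set v : 'rV[R]_m | forall i, v ord0 i \in `[- K, K]].
  apply: (@rV_compact _ _ (fun=> `[- K, K]%classic)) => _.
  exact: segment_compact.
have : compact [set v : 'cV[R]_m | forall i, v i 0 \in `[- K, K]].
  rewrite (_ : [set v | _] = @trmx R 1 m @`
      [set v : 'rV[R]_m | forall i, v ord0 i \in `[- K, K]]).
    apply: continuous_compact => //; apply: continuous_subspaceT.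
    exact: trmx_continuous.
  apply/seteqP; split => [v vK|_ [v vK <-]] /=.
    by exists v^T; rewrite ?trmxK // => i; rewrite mxE; exact: vK.
  by move=> i; rewrite mxE; exact: vK.
move=> cB; apply: (subclosed_compact cS cB) => x /bS xK i.
by rewrite in_itv /= -ler_norml.
Qed.

Lemma compact_min (T : topologicalType) (S : set T) (f : T -> R) :
  compact S -> S !=set0 -> {in S, continuous f} ->
  exists2 x, S x & forall y, S y -> f x <= f y.
Proof.
move=> cS S0 cf.
have [|x /set_mem Sx xmin] := compact_EVT_min S0 cS (f := f).
  by apply: continuous_in_subspaceT => x xS; exact: cf.
by exists x => // y Sy; apply: xmin; rewrite inE.
Qed.

Lemma norm_coord_le m (x : 'cV[R]_m) i : `|x i 0| <= `|x|.
Proof.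
rewrite (_ : `|x| = mx_norm x) // mx_normrE.
exact: (le_bigmax _ (fun ij : 'I_m * 'I_1 => `|x ij.1 ij.2|) (i, 0)).
Qed.

End ColumnTopology.

(** * Chambers *)

Section Chambers.
Variables (R : realType) (d n : nat) (A : 'M[R]_(d, n)).

Lemma dotpE m (u v : 'cV[R]_m) : dotp u v = \sum_i u i 0 * v i 0.
Proof. by rewrite /dotp mxE; apply: eq_bigr => i _; rewrite mxE. Qed.

Lemma dotpDr m (u v w : 'cV[R]_m) : dotp u (v + w) = dotp u v + dotp u w.
Proof. by rewrite /dotp mulmxDr mxE. Qed.

Lemma dotpZr m (u v : 'cV[R]_m) a : dotp u (a *: v) = a * dotp u v.
Proof. by rewrite /dotp -scalemxAr mxE. Qed.

Lemma dotpNr m (u v : 'cV[R]_m) : dotp u (- v) = - dotp u v.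
Proof. by rewrite /dotp mulmxN mxE. Qed.

Lemma dotpBr m (u v w : 'cV[R]_m) : dotp u (v - w) = dotp u v - dotp u w.
Proof. by rewrite dotpDr dotpNr. Qed.

Lemma dotp_continuous m (u : 'cV[R]_m) : continuous (dotp u).
Proof.
move=> x; have := @coord_cvg R _ (nbhs x) _ _ _ (fun v => u^T *m v) (u^T *m x) 0 0.
by apply; exact: mulmx_continuous.
Qed.

Lemma small_step m (x u : 'cV[R]_m) :
  exists2 e : R, 0 < e & forall t i, `|t| <= e -> 0 < x i 0 ->
    0 < (x + t *: u) i 0.
Proof.
(* The summand 1 gives [|t * u i 0| + |t| <= x i 0], hence a strict inequality for nonzero [t], and
   it covers [u i 0 = 0]. *)
pose f i := if 0 < x i 0 then x i 0 / (`|u i 0| + 1) else 1.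
have f0 i : 0 < f i.
  rewrite /f; case: ifP => // xi.
  by rewrite divr_gt0 // ltr_wpDl.
exists (\big[Num.min/1]_i f i).
  by apply: lt_bigmin => // i _; exact: ltr01.
move=> t i te xi; have : `|t| <= f i by apply: le_trans te (bigmin_le _ _ _).
rewrite /f xi ler_pdivlMr ?ltr_wpDl // mulrDr mulr1 => tx.
rewrite !mxE; have : `|t * u i 0| < x i 0 \/ t = 0.
  have [->|t0] := eqVneq t 0; [by right|left].
  by rewrite normrM; apply: lt_le_trans tx; rewrite ltrDl normr_gt0.
case=> [|->]; last by rewrite mul0r addr0.
by rewrite ltr_norml => /andP[h _]; rewrite -ltrBlDl sub0r.
Qed.

Lemma interior_step m (C : set 'cV[R]_m) p v : C° p ->
  exists2 e : R, 0 < e & forall t, `|t| <= e -> C (p + t *: v).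
Proof.
move=> Cp.
have cf : (fun t : R => p + t *: v) @ (0 : R) --> p.
  suff : (fun t : R => p + t *: v) @ (0 : R) --> p + 0 *: v by rewrite scale0r addr0.
  by apply: cvgD; [exact: cvg_cst|apply: cvgZr_tmp; exact: cvg_id].
have /nbhs_ballP[e /= e0 eC] := cf _ Cp.
exists (e / 2); first by rewrite divr_gt0.
move=> t te; apply: (eC t); rewrite /ball /= sub0r normrN.
by apply: le_lt_trans te _; rewrite ltr_pdivrMr // ltr_pMr // ltr1n.
Qed.

(** Extrapolation along a line: arbitrarily far points lie in the hull as soon as a short step from
    [q] towards them stays in [S]. *)
Lemma aff_hull_line m (S : set 'cV[R]_m) q y s : s != 0 -> S q ->
  S (q + s *: (y - q)) -> aff_hull S y.
Proof.
move=> s0 Sq Sy.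
exists 2, (fun i => if i == 0 then q else q + s *: (y - q)),
  (fun i => if i == 0 then 1 - s^-1 else s^-1); split.
- by move=> i; case: ifP.
- by rewrite !big_ord_recl big_ord0 /= addr0 subrK.
- rewrite !big_ord_recl big_ord0 /= addr0 scalerDr scalerA mulVf // scale1r.
  by rewrite scalerBl scale1r addrA addrNK addrC subrK.
Qed.

Lemma aff_dim_interior m (C : set 'cV[R]_m) p : C° p -> aff_dim C m.
Proof.
move=> Cp; exists 0, 1%:M; split; first exact: mxrank1.
apply/seteqP; split => y // _; first by exists y => //; rewrite mul1mx add0r.
have [e e0 eC] := interior_step (y - p) Cp.
apply: (@aff_hull_line _ _ p y e); first by rewrite gt_eqF.
  exact: interior_subset Cp.
by apply: eC; rewrite gtr0_norm.
Qed.

Definition supported (s : {set 'I_n}) (x : 'cV[R]_n) := forall i, i \notin s -> x i 0 = 0.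

Definition support (x : 'cV[R]_n) : {set 'I_n} := finset (fun i => 0 < x i 0).

Lemma supported_support (x : 'cV[R]_n) : orthant_ge0 x -> supported (support x) x.
Proof.
move=> x0 i; rewrite inE -leNgt => xi.
by apply/eqP; rewrite eq_le xi x0.
Qed.

Lemma cone_colselP s b : cone (colsel A s) b <->
  exists x, [/\ orthant_ge0 x, supported s x & A *m x = b].
Proof.
pose S := \matrix_(i < n, j < #|s|) (i == enum_val j)%:R : 'M[R]_(n, #|s|).
have AS : colsel A s = A *m S.
  apply/matrixP => i j; rewrite !mxE (bigD1 (enum_val j)) //= big1 => [|k kj].
    by rewrite mxE eqxx mulr1 addr0.
  by rewrite mxE (negPf kj) mulr0.
split=> [[y y0 <-]|[x [x0 xs <-]]].
  exists (S *m y); split; last by rewrite AS mulmxA.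
    move=> i; rewrite mxE sumr_ge0 // => j _; rewrite mulr_ge0 //.
    by rewrite mxE ler0n.
  move=> i is_; rewrite mxE big1 // => j _; rewrite mxE.
  case: eqP => [ij|_]; last by rewrite mul0r.
  by rewrite ij enum_valP in is_.
exists (\col_j x (enum_val j) 0); first by move=> j; rewrite mxE.
apply/matrixP => i j; rewrite ord1 !mxE.
transitivity (\sum_(k in s) A i k * x k 0).
  by rewrite [RHS]big_enum_val; apply: eq_bigr => k _; rewrite !mxE.
rewrite [RHS](bigID (mem s)) /= [X in _ + X]big1 ?addr0 // => k ks.
by rewrite xs // mulr0.
Qed.

Lemma coneE b : cone A b <-> fiber A b !=set0.
Proof. by split=> [[x x0 <-]|[x [x0 <-]]]; exists x. Qed.

Lemma cone_colselT b : cone (colsel A [set: 'I_n]%SET) b <-> cone A b.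
Proof.
rewrite cone_colselP; split=> [[x [x0 _ <-]]|[x x0 <-]]; exists x => //.
by split => // i; rewrite inE.
Qed.

Lemma cone_support x b : fiber A b x -> cone (colsel A (support x)) b.
Proof.
move=> [x0 xb]; apply/cone_colselP; exists x; split => //.
exact: supported_support.
Qed.

Lemma chamber_sub s b : cone (colsel A s) b -> chamber A b `<=` cone (colsel A s).
Proof. by move=> sb c; apply. Qed.

(** Dual form of the condition that [b] lies in no cone on columns that fail to span the space; [y]
    is a linear form killing the columns on the support of [x]. *)
Definition generic b := forall x, fiber A b x ->
  forall y : 'rV[R]_d, (forall i, 0 < x i 0 -> (y *m A) 0 i = 0) -> y = 0.

Lemma mulmx_kills (y : 'rV[R]_d) (x : 'cV[R]_n) :
  (forall i, x i 0 != 0 -> (y *m A) 0 i = 0) -> y *m (A *m x) = 0.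
Proof.
move=> yx; apply/matrixP => i j; rewrite !ord1 mulmxA mxE big1 ?mxE // => k _.
by have [->|xk] := eqVneq (x k 0) 0; rewrite ?mulr0 // yx // mul0r.
Qed.

(** The columns on the support of [x] generate a cone containing the whole chamber. A form that
    kills them kills the chamber and then its affine hull, which is the full space. *)
Lemma cell_generic b : aff_dim (chamber A b) d -> generic b.
Proof.
move=> [c0 [V [rV aff]]] x xb y yx.
have yC c : chamber A b c -> y *m c = 0.
  move=> /(chamber_sub (cone_support xb)) /cone_colselP [z [z0 zs <-]].
  apply: mulmx_kills => i zi; apply: yx.
  by apply: contraNT zi => xi; rewrite zs // inE.
have Vu : V \in unitmx by rewrite -row_full_unit /row_full rV.
have yall (u : 'cV[R]_d) : y *m u = 0.
  have : aff_hull (chamber A b) u.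
    rewrite aff; exists (invmx V *m (u - c0)) => //.
    by rewrite mulmxA mulmxV // mul1mx addrC subrK.
  move=> [k [p [w [pC _ ->]]]]; rewrite mulmx_sumr big1 // => i _.
  by rewrite -scalemxAr yC ?scaler0.
apply/matrixP => i j; rewrite ord1 mxE.
have := yall (delta_mx j 0); rewrite -colE => /matrixP /(_ 0 0).
by rewrite !mxE.
Qed.

Lemma right_inverse_supported (s : {set 'I_n}) :
  (forall y : 'rV[R]_d, (forall i, i \in s -> (y *m A) 0 i = 0) -> y = 0) ->
  exists N : 'M[R]_(n, d), A *m N = 1%:M /\ forall i j, i \notin s -> N i j = 0.
Proof.
move=> sA; pose D : 'M[R]_n := diag_mx (\row_i (i \in s)%:R).
have /row_freeP[N AN] : row_free (A *m D).
  rewrite -kermx_eq0; apply/eqP/row_matrixP => k; rewrite row0.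
  apply: sA => i si.
  have : row k (kermx (A *m D)) *m (A *m D) = 0.
    by apply/sub_kermxP; exact: row_sub.
  rewrite mulmxA => /matrixP /(_ 0 i).
  rewrite [RHS]mxE mul_mx_diag mxE [X in _ * X]mxE si mulr1.
  by [].
exists (D *m N); split; first by rewrite mulmxA.
by move=> i j si; rewrite mul_diag_mx !mxE (negPf si) mul0r.
Qed.

(** With a right inverse [N] of [A] living on the support of [x], the point [x + N *m (c - b)] lies
    over [c] and alters only positive coordinates of [x], which stay positive for [c] near [b]. *)
Lemma span_nbhs s x : orthant_ge0 x -> supported s x ->
  (forall y : 'rV[R]_d, (forall i, 0 < x i 0 -> (y *m A) 0 i = 0) -> y = 0) ->
  nbhs (A *m x) (cone (colsel A s)).
Proof.
move=> x0 xs spanx; set b := A *m x.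
have [|N [AN N0]] := @right_inverse_supported (support x).
  by move=> y yx; apply: spanx => // i xi; apply: yx; rewrite inE.
pose f c := x + N *m (c - b).
have fb : f @ b --> x.
  suff : f @ b --> x + N *m (b - b) by rewrite subrr mulmx0 addr0.
  apply: (@cvgD _ _ _ (nbhs b) _ (fun=> x) (fun c => N *m (c - b))).
    exact: cvg_cst.
  apply: (@cvg_mulmx _ _ (nbhs b) _ _ _ _ N (fun c => c - b)).
  by apply: cvgB; [exact: cvg_id|exact: cvg_cst].
have : \forall c \near b, forall i, 0 < x i 0 -> 0 < f c i 0.
  apply: (@filter_forall _ _ (fun i c => 0 < x i 0 -> 0 < f c i 0) (nbhs b)) => i.
  have [xi|xi] := boolP (0 < x i 0); last exact: nearW.
  have : \forall c \near b, 0 < f c i 0.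
    apply: (@cvgr_gt _ _ (nbhs b) _ (fun c => f c i 0) (x i 0)) => //.
    exact: coord_cvg.
  by apply: filterS.
apply: filterS => c fc; apply/cone_colselP; exists (f c).
have f_out i : i \notin support x -> f c i 0 = x i 0.
  move=> xi; rewrite mxE [X in _ + X]mxE big1 ?addr0 // => j _.
  by rewrite N0 // mul0r.
split.
- move=> i; have [xi|xi] := boolP (0 < x i 0); first exact/ltW/fc.
  by rewrite f_out ?inE.
- move=> i si; rewrite f_out ?xs // inE xs // ltxx.
  by [].
- by rewrite mulmxDr mulmxA AN mul1mx addrC subrK.
Qed.

Lemma generic_nbhs b s : generic b -> cone (colsel A s) b ->
  nbhs b (cone (colsel A s)).
Proof.
move=> gb /cone_colselP[x [x0 xs xb]]; rewrite -xb.
by apply: span_nbhs => // y; exact: gb.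
Qed.

Lemma generic_interior b : generic b -> (chamber A b)° b.
Proof.
move=> gb.
have : \forall c \near b, forall s, cone (colsel A s) b -> cone (colsel A s) c.
  apply: (@filter_forall _ _ (fun s c => cone (colsel A s) b -> cone (colsel A s) c)
    (nbhs b)) => s.
  have [sb|sb] := pselect (cone (colsel A s) b); last by apply: nearW.
  by have := generic_nbhs gb sb; apply: filterS.
by apply: filterS => c h s; exact: h.
Qed.

Lemma interior_cone_pos b : (cone A)° b -> pos A b.
Proof.
move=> /(interior_step (- (A *m const_mx 1)))[e e0 /(_ e)].
rewrite gtr0_norm // lexx => /(_ isT)[x x0 xe].
exists (x + e *: const_mx 1).
  by move=> i; rewrite !mxE mulr1 ltr_wpDl.
by rewrite mulmxDr xe -scalemxAr scalerN subrK.
Qed.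

Hypotheses (A_ge0 : forall i j, 0 <= A i j) (A_col : forall j, col j A != 0).

(** Each column has a positive entry [A (r j) j]. Nothing cancels in row [r j], so this entry alone
    bounds [x j 0]; the sum of all inverses is a common constant. *)
Lemma fiber_bound : exists2 K : R, 0 <= K & forall x : 'cV[R]_n, orthant_ge0 x ->
  forall j, x j 0 <= K * `|A *m x|.
Proof.
have rowj j : exists i, 0 < A i j.
  apply/existsP; apply: contraT; rewrite negb_exists => /forallP Aj.
  case/negP: (A_col j); apply/eqP/matrixP => i k; rewrite !mxE.
  by apply/eqP; rewrite eq_le A_ge0 andbT leNgt.
pose r j := xchoose (rowj j).
have rP j : 0 < A (r j) j := xchooseP (rowj j).
exists (\sum_j (A (r j) j)^-1).
  by rewrite sumr_ge0 // => j _; rewrite invr_ge0.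
move=> x x0 j.
have xj : x j 0 <= (A (r j) j)^-1 * `|A *m x|.
  rewrite mulrC ler_pdivlMr // mulrC.
  apply: le_trans (le_trans (ler_norm _) (norm_coord_le (A *m x) (r j))).
  rewrite mxE (bigD1 j) //= lerDl sumr_ge0 // => k _; exact: mulr_ge0.
apply: le_trans xj _; apply: ler_wpM2r => //.
by rewrite (bigD1 j) //= lerDl sumr_ge0 // => k _; rewrite invr_ge0.
Qed.

Lemma fiber_closed b : closed (fiber A b).
Proof.
apply: closedI; last exact: closed_mulmx_eq.
by apply: closed_forall => i; exact: closed_coord_ge.
Qed.

Lemma fiber_compact b : compact (fiber A b).
Proof.
have [K K0 xK] := fiber_bound.
apply: (cV_compact (K := K * `|b|)) => [|x [x0 xb] i]; first exact: fiber_closed.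
by rewrite ger0_norm // -xb; exact: xK.
Qed.

Lemma fiber_argmin b c : fiber A b !=set0 ->
  exists2 x, fiber A b x & forall y, fiber A b y -> dotp c x <= dotp c y.
Proof.
move=> b0; apply: compact_min => //; first exact: fiber_compact.
by move=> x _; exact: dotp_continuous.
Qed.

(* If x0 minimises the total mass outside s over the fiber of b, then
   everything in the chamber of b is representable on the support of x0;
   pushing x0 towards a representation of p inside s and away from one whose
   support is that of x0 cannot decrease the cost, so supp x0 is in s. *)
Lemma interior_chamber_cone b p s : cone A b -> (chamber A b)° p ->
  cone (colsel A s) p -> cone (colsel A s) b.
Proof.
move=> /coneE b0 Cp /cone_colselP[z [z0 zs zp]].
pose c : 'cV[R]_n := \col_i (i \notin s)%:R.
have [x xb xmin] := fiber_argmin c b0.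
pose one : 'cV[R]_n := \col_i (i \in support x)%:R.
have [e e0 eC] := interior_step (- (A *m one)) Cp.
have /(chamber_sub (cone_support xb)) /cone_colselP[w [w0 ws wp]] :
  chamber A b (p + e *: - (A *m one)) by apply: eC; rewrite gtr0_norm.
pose v := w + e *: one.
have vp : A *m v = p by rewrite mulmxDr wp -scalemxAr scalerN subrK.
have v_pos i : i \in support x -> 0 < v i 0.
  by move=> xi; rewrite !mxE xi mulr1 ltr_wpDl.
have v_out i : i \notin support x -> v i 0 = 0.
  by move=> xi; rewrite !mxE (negPf xi) mulr0 addr0 ws.
have [t t0 tstep] := small_step x (z - v).
have tx : fiber A b (x + t *: (z - v)).
  split; last by rewrite mulmxDr -scalemxAr mulmxBr zp vp subrr scaler0 addr0; case: xb.
  move=> i; have [xi|xi] := boolP (0 < x i 0).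
    by apply/ltW/tstep => //; rewrite gtr0_norm.
  have vi : v i 0 = 0 by rewrite v_out // inE.
  have -> : (x + t *: (z - v)) i 0 = x i 0 + t * (z i 0 - v i 0) by rewrite !mxE.
  rewrite vi subr0 addr_ge0 //; first by case: xb.
  by rewrite mulr_ge0 // ltW.
have := xmin _ tx; rewrite dotpDr lerDl dotpZr pmulr_rge0 // dotpBr.
have -> : dotp c z = 0.
  rewrite dotpE big1 // => i _; rewrite mxE.
  by have [si|si] := boolP (i \in s); [rewrite mul0r|rewrite mul1r zs].
rewrite sub0r oppr_ge0 => cv.
have v0 i : 0 <= v i 0.
  by have [xi|xi] := boolP (i \in support x); [exact/ltW/v_pos|rewrite v_out].
have vs i : i \notin s -> v i 0 = 0.
  move=> si; apply/eqP; rewrite eq_le v0 andbT; apply: le_trans cv.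
  rewrite dotpE (bigD1 i) //= [c i 0]mxE si mul1r lerDl sumr_ge0 // => j _.
  by rewrite mulr_ge0 // mxE ler0n.
apply/cone_colselP; exists x; case: xb => x0 xb; split => // i si.
apply: (supported_support x0); apply: contraT => /negbNE xi.
by have := v_pos i xi; rewrite vs // ltxx.
Qed.

(** By [interior_chamber_cone], the support of any point over [p] also carries a point over [b],
    where genericity is known. *)
Lemma interior_chamber_generic b p : cone A b -> generic b ->
  (chamber A b)° p -> generic p.
Proof.
move=> bA gb Cp x xp y yx.
have /cone_colselP[z [z0 zs zb]] := interior_chamber_cone bA Cp (cone_support xp).
apply: (gb z) => // i zi; apply: yx.
by apply: contraTT zi => xi; rewrite zs ?ltxx // inE.
Qed.

Lemma chamber_sub_cone b : cone A b -> chamber A b `<=` cone A.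
Proof. by move=> /cone_colselT /chamber_sub Cb c /Cb /cone_colselT. Qed.

Lemma interior_chamber_pos b p : cone A b -> (chamber A b)° p -> pos A p.
Proof.
by move=> bA Cp; apply: interior_cone_pos; apply: interiorS Cp; exact: chamber_sub_cone.
Qed.

End Chambers.

(** * Every point of [pos] lies in a cell *)

Section CellCover.
Variables (R : realType) (d n : nat) (A : 'M[R]_(d, n)).

Lemma avoid_values (s : seq R) (e : R) : 0 < e -> exists2 t, 0 < t <= e & t \notin s.
Proof.
(* Strengthened for the induction: a whole interval []0, t]] is free of the values in [s]. *)
move=> e0; suff [t [t0 te ts]] : exists t, [/\ 0 < t, t <= e &
    forall r, 0 < r <= t -> r \notin s].
  by exists t; [rewrite t0|apply: ts; rewrite t0 /=].
elim: s => [|z s [t [t0 te ts]]]; first by exists e.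
have [z0|z0] := ltrP 0 z.
  exists (Num.min t (z / 2)); split; first by rewrite lt_min t0 divr_gt0.
    by rewrite ge_min te.
  move=> r; rewrite le_min in_cons negb_or => /and3P[r0 rt rz].
  rewrite ts ?r0 // andbT; apply/eqP => rz'; move: rz; rewrite rz'.
  by rewrite ler_pdivlMr // mulr_natr mulr2n gerDl leNgt z0.
exists t; split => // r /andP[r0 rt]; rewrite in_cons negb_or ts ?r0 // andbT.
by rewrite gt_eqF // (le_lt_trans z0).
Qed.

Lemma avoid_hyperplanes (ys : seq 'rV[R]_d) : 0 \notin ys ->
  exists u : 'cV[R]_d, forall y, y \in ys -> (y *m u) 0 0 != 0.
Proof.
elim: ys => [|y ys IH]; first by exists 0.
rewrite in_cons negb_or eq_sym => /andP[y0 /IH[u uP]].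
have [yu|yu] := eqVneq ((y *m u) 0 0) 0; last first.
  by exists u => z; rewrite in_cons => /predU1P[->//|]; exact: uP.
(* If [u] lies on the hyperplane of [y], it is moved off in the normal direction [v]. Each other
   hyperplane excludes at most one step length. *)
pose v := y^T.
have yv : (y *m v) 0 0 != 0.
  rewrite mxE psumr_eq0; last by move=> i _; rewrite mxE -expr2 sqr_ge0.
  apply: contra y0 => /allP h; apply/eqP/matrixP => i j; rewrite ord1 mxE.
  have := h j (mem_index_enum _); rewrite implyTb mxE -expr2 sqrf_eq0.
  by move/eqP.
have [t /andP[t0 _] ts] := avoid_values
  [seq - (z *m u) 0 0 / (z *m v) 0 0 | z <- ys] ltr01.
exists (u + t *: v) => z; rewrite in_cons => /predU1P[->|zs].
  by rewrite mulmxDr -scalemxAr mxE [X in _ + X]mxE yu add0r mulf_neq0 // gt_eqF.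
rewrite mulmxDr -scalemxAr mxE [X in _ + X]mxE.
have [zv|zv] := eqVneq ((z *m v) 0 0) 0; first by rewrite zv mulr0 addr0 uP.
apply: contra ts => /eqP h; apply/mapP; exists z => //.
by apply: (mulIf zv); rewrite divfK //; apply/eqP; rewrite -addr_eq0 addrC h.
Qed.

Hypotheses (A_ge0 : forall i j, 0 <= A i j) (A_col : forall j, col j A != 0).

(** By [fiber_bound], all vectors representing points of the unit ball around [b] lie in one box, so
    near [b] the cone is the image of a compact set. *)
Lemma cone_closed s : closed (cone (colsel A s)).
Proof.
move=> b bcl; have [K K0 xK] := fiber_bound A_ge0 A_col.
pose S := [set x : 'cV[R]_n | (forall i, 0 <= x i 0) /\
  ((forall i, i \notin s -> x i 0 = 0) /\ (forall i, x i 0 <= K * (`|b| + 1)))].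
have cS : compact S.
  apply: (@cV_compact _ _ _ (K * (`|b| + 1))) => [|x [x0 [_ xb]] i]; last first.
    by rewrite ger0_norm.
  apply: closedI; first by apply: closed_forall => i; exact: closed_coord_ge.
  apply: closedI; last by apply: closed_forall => i; exact: closed_coord_le.
  apply: (@closed_forall _ _ (fun i => [set x : 'cV[R]_n | i \notin s -> x i 0 = 0])) => i.
  have [si|si] := boolP (i \in s).
    by rewrite [X in closed X](_ : _ = setT); [exact: closedT|apply/seteqP; split].
  have := @closed_coord_eq R n i 0; congr (closed _).
  by apply/seteqP; split => x //=; apply.
have clAS : closed [set A *m x | x in S].
  apply: compact_closed; first exact: norm_hausdorff.
  apply: continuous_compact => //; apply: continuous_subspaceT.
  exact: mulmx_continuous.
have : [set A *m x | x in S] b.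
  apply: clAS => W Wb.
  have [c [cs [Wc cb]]] := bcl _ (filterI Wb (nbhsx_ballx b 1 ltr01)).
  exists c; split => //.
  move/cone_colselP : cs => [x [x0 xs xc]]; exists x => //; split => //; split => // i.
  apply: le_trans (xK _ x0 i) _; rewrite xc ler_wpM2l //.
  move: cb; rewrite mx_norm_ball /ball_ /= => cb.
  rewrite -lerBlDl; apply: le_trans (ltW cb); rewrite distrC.
  exact: lerB_dist.
move=> [x [x0 [xs _]] <-]; apply/cone_colselP; by exists x.
Qed.

Hypothesis A_rank : \rank A = d.

Lemma pos_interior b : pos A b -> (cone A)° b.
Proof.
move=> [x x0 <-].
have /= := @span_nbhs _ _ _ A [set: 'I_n]%SET x; rewrite /interior => h.
apply: filterS (h _ _ _) => [c /cone_colselT //|i|i|y yx]; first exact/ltW.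
  by rewrite inE.
have : y *m A = 0 by apply/matrixP => i j; rewrite ord1 yx ?mxE.
by move/eqP; rewrite mulmx_free_eq0 ?/row_free ?A_rank // => /eqP.
Qed.

Lemma cells_cover b : pos A b -> exists2 C, cells A C & C b.
Proof.
move=> bpos.
pose thin (T : {set 'I_n}) (y : 'rV[R]_d) := y != 0 /\ forall i, i \in T -> (y *m A) 0 i = 0.
(* [yT T] picks a nonzero form killing the columns in [T]. It is the default 0 when these columns
   span, and [ys] drops that case. *)
pose yT T := xget 0 (thin T).
pose ys := [seq yT T | T <- enum {set 'I_n} & yT T != 0].
have [|u uP] := @avoid_hyperplanes ys.
  by apply/negP => /mapP[T]; rewrite mem_filter => /andP[T0 _] /esym /eqP; rewrite (negPf T0).
have bnear : \forall c \near b, cone A c /\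
    forall s, ~ cone (colsel A s) b -> ~ cone (colsel A s) c.
  apply: filterI; first exact: pos_interior.
  apply: (@filter_forall _ _ (fun s c => ~ cone (colsel A s) b -> ~ cone (colsel A s) c)
    (nbhs b)) => s.
  have [sb|sb] := pselect (cone (colsel A s) b); first exact: nearW.
  have : nbhs b (~` cone (colsel A s)).
    by apply: open_nbhs_nbhs; split => //; apply: closed_openC; exact: cone_closed.
  by apply: filterS.
have [e e0 eP] := interior_step u bnear.
(* The listed values are the parameters at which [b + t *: u] meets the hyperplane of some [y] in
   [ys]. *)
have [t /andP[t0 te] ts] := avoid_values
  [seq - (y *m b) 0 0 / (y *m u) 0 0 | y <- ys] e0.
have [] := eP t; first by rewrite gtr0_norm.
set c := b + t *: u => cA cP.
have gc : generic A c.
  move=> x xc y yx; apply/eqP; apply: contraT => y0.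
  have thinx : thin (support x) (yT (support x)).
    apply: (@xgetPex _ 0 (thin (support x))); exists y; split => // i.
    by rewrite inE; exact: yx.
  have yTs : yT (support x) \in ys.
    by apply/mapP; exists (support x) => //; rewrite mem_filter mem_enum andbT; case: thinx.
  set z := yT _ in thinx yTs; have zu := uP _ yTs.
  case/negP: ts; apply/mapP; exists z => //.
  have : (z *m c) 0 0 = 0.
    case: xc => x0 <-; rewrite mulmx_kills ?mxE // => i xi.
    by case: thinx => _; apply; rewrite inE lt_neqAle eq_sym xi x0.
  rewrite /c mulmxDr -scalemxAr mxE [X in _ + X]mxE => h.
  by apply: (mulIf zu); rewrite divfK //; apply/eqP; rewrite -addr_eq0 addrC h.
exists (chamber A c).
  split; first by exists c.
  exact: aff_dim_interior (generic_interior gc).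
move=> s sc; apply: contrapT => sb; exact: cP sb sc.
Qed.

End CellCover.

(** * Vertices and facets of the fibers *)

Section IndexEnumeration.
Variable n : nat.

(* The k-th element of I; the default value is only reached when #|I| <= k. *)
Definition index_of k (kn : (k <= n)%N) (I : {set 'I_n}) (j : 'I_k) : 'I_n :=
  nth (widen_ord kn j) (enum I) j.

Variables (k : nat) (kn : (k <= n)%N) (I : {set 'I_n}).
Hypothesis cardI : #|I| = k.

Lemma index_of_in j : index_of kn I j \in I.
Proof. by rewrite -mem_enum mem_nth // -cardE cardI. Qed.

Lemma index_of_inj : injective (index_of kn I).
Proof.
move=> i j /eqP; rewrite /index_of (set_nth_default (widen_ord kn j)) -?cardE ?cardI //.
rewrite nth_uniq ?enum_uniq -?cardE ?cardI // => /eqP ij.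
exact: val_inj.
Qed.

Lemma index_of_surj i : i \in I -> exists j, i = index_of kn I j.
Proof.
move=> iI; have ik : (index i (enum I) < k)%N by rewrite -cardI cardE index_mem mem_enum.
by exists (Ordinal ik); rewrite /index_of nth_index // mem_enum.
Qed.

Lemma big_index_of (T : Type) (idx : T) (op : Monoid.com_law idx) (F : 'I_n -> T) :
  \big[op/idx]_(i in I) F i = \big[op/idx]_(j < k) F (index_of kn I j).
Proof.
have -> : I = [set index_of kn I j | j in 'I_k]%SET.
  apply/setP => i; apply/idP/imsetP => [/index_of_surj[j ->]|[j _ ->]].
    by exists j.
  exact: index_of_in.
rewrite big_imset /=; last by move=> i j _ _; exact: index_of_inj.
apply: eq_bigr => j _; congr (F _).
rewrite /index_of.
have -> // : [set nth (widen_ord kn j0) (enum I) j0 | j0 in 'I_k]%SET = I.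
apply/setP => i; apply/imsetP/idP => [[j' _ ->]|/index_of_surj[j' ->]].
  exact: index_of_in.
by exists j'.
Qed.

End IndexEnumeration.

(** * Vertices as basic feasible solutions *)

Section BasicSolutions.
Variables (R : realType) (d n : nat) (A : 'M[R]_(d, n)).

(** The basic feasible solutions of linear programming: the columns of [A] on the support of [v] are
    independent. *)
Definition basic b (v : 'cV[R]_n) := fiber A b v /\
  forall z, A *m z = 0 -> supported (support v) z -> z = 0.

Lemma kernel_step b v z : fiber A b v -> A *m z = 0 -> supported (support v) z ->
  exists2 t : R, 0 < t & fiber A b (v + t *: z) /\ fiber A b (v - t *: z).
Proof.
move=> [v0 vb] Az vz; have [t t0 tstep] := small_step v z.
have step s : `|s| <= t -> fiber A b (v + s *: z).
  move=> st; split; last by rewrite mulmxDr -scalemxAr Az scaler0 addr0.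
  move=> i; have [vi|vi] := boolP (0 < v i 0); first exact/ltW/tstep.
  by rewrite !mxE vz ?inE // mulr0 addr0 v0.
exists t => //; split; first by apply: step; rewrite gtr0_norm.
by rewrite -scaleNr; apply: step; rewrite normrN gtr0_norm.
Qed.

(** The exposing functional is minus the sum of the coordinates outside the support of [v]. It is at
    most 0 on the fiber, and where it is 0 the difference to [v] is a kernel vector on that
    support. *)
Lemma basic_vertex b v : basic b v -> is_vertex (fiber A b) v.
Proof.
move=> [vb vz]; split; first by exists v.
pose c : 'cV[R]_n := \col_i - (i \notin support v)%:R.
have cE x : dotp c x = - \sum_(i | i \notin support v) x i 0.
  rewrite dotpE (bigID (mem (support v))) /= big1 ?add0r => [|i si]; last first.
    by rewrite mxE si oppr0 mul0r.
  by rewrite -sumrN; apply: eq_bigr => i si; rewrite mxE si mulN1r.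
exists c, 0; split.
  by move=> x [x0 _]; rewrite cE oppr_le0 sumr_ge0.
apply/seteqP; split => x /= => [->|[xb]].
  split => //; rewrite cE big1 ?oppr0 // => i si.
  by apply: supported_support => //; case: vb.
rewrite cE => /eqP; rewrite oppr_eq0 psumr_eq0; last by case: xb.
move=> /allP x0; apply/eqP; rewrite -subr_eq0; apply/eqP/vz.
  by rewrite mulmxBr; case: xb vb => _ -> [_ ->]; rewrite subrr.
move=> i si; rewrite mxE [X in _ + X]mxE.
have /eqP -> : x i 0 == 0 by have := x0 i (mem_index_enum _); rewrite si.
rewrite (supported_support _ si) ?subrr //; by case: vb.
Qed.

(** A kernel vector on the support of [v] spans a segment in the fiber centred at [v]. The exposing
    functional is maximal at the centre, hence constant on the segment, which must be a point. *)
Lemma vertex_basic b v : is_vertex (fiber A b) v -> basic b v.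
Proof.
move=> [_ [c [e [ce vE]]]].
have [vb cv] : (fiber A b `&` [set x | dotp c x = e]) v by rewrite -vE.
split => // z Az vz.
have [t t0 [h1 h2]] := kernel_step vb Az vz.
have /= cv' := cv.
have cz : dotp c z = 0.
  apply/eqP; rewrite eq_le; apply/andP; split.
    by have := ce _ h1; rewrite dotpDr cv' gerDl dotpZr pmulr_rle0.
  by have := ce _ h2; rewrite dotpBr cv' gerBl dotpZr pmulr_rge0.
have : [set v] (v + t *: z).
  by rewrite vE; split => //=; rewrite dotpDr dotpZr cz mulr0 addr0.
move=> /= /eqP; rewrite -subr_eq0 addrAC subrr add0r scaler_eq0 gt_eqF //=.
by move/eqP.
Qed.

Hypotheses (A_ge0 : forall i j, 0 <= A i j) (A_col : forall j, col j A != 0).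

(** The ratio test of the simplex method: [r i] is the step at which coordinate [i] reaches 0, and
    the smallest such step is taken. *)
Lemma shrink_support b v z : fiber A b v -> A *m z = 0 -> supported (support v) z ->
  (exists i, z i 0 < 0) ->
  exists2 t, 0 < t & fiber A b (v + t *: z) /\ support (v + t *: z) \proper support v.
Proof.
move=> [v0 vb] Az vz [i0 zi0].
pose r i := v i 0 / - z i 0.
have [i zi imin] : exists2 i, z i 0 < 0 & forall j, z j 0 < 0 -> r i <= r j.
  by case: (@arg_minP _ _ _ i0 [pred j | z j 0 < 0] r zi0) => i zi h; exists i.
have vi i' : z i' 0 != 0 -> 0 < v i' 0.
  by apply: contraNT => vi; rewrite vz // inE.
have ri : 0 < r i by rewrite divr_gt0 ?oppr_gt0 // vi // lt_eqF.
have E j : (v + r i *: z) j 0 = v j 0 + r i * z j 0 by rewrite !mxE.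
exists (r i) => //; split.
  split; last by rewrite mulmxDr -scalemxAr Az scaler0 addr0.
  move=> j; rewrite E; have [zj|zj] := ltrP (z j 0) 0.
    have := imin j zj; rewrite /r ler_pdivlMr ?oppr_gt0 // mulrN => h.
    by rewrite -lerBlDr sub0r.
  by rewrite addr_ge0 ?v0 // mulr_ge0 // ltW.
apply/properP; split.
  apply/fintype.subsetP => j; rewrite !inE E => h.
  apply: contraTT h => vj; have := vz j; rewrite inE => -> //.
  by rewrite mulr0 addr0.
exists i; first by rewrite inE vi // lt_eqF.
by rewrite inE E /r invrN mulrN mulNr divfK ?lt_eqF // subrr ltxx.
Qed.

(** A minimiser of minimal support is basic. Along a kernel vector on its support the cost is
    constant, since small steps of both signs stay in the fiber, and the ratio test would shrink the
    support. *)
Lemma basic_argmin b c : fiber A b !=set0 -> exists2 v, basic b v &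
  forall y, fiber A b y -> dotp c v <= dotp c y.
Proof.
move=> b0; have [x xb xmin] := fiber_argmin A_ge0 A_col c b0.
pose opt v := fiber A b v /\ forall y, fiber A b y -> dotp c v <= dotp c y.
pose P := [pred T : {set 'I_n} | `[< exists2 v, opt v & support v = T >]].
have [T /minsetP[/asboolP[v [vb vmin] <-] Tmin] _] :
    {T : {set 'I_n} | minset P T & T \subset support x}.
  by apply: minset_exists; apply/asboolP; exists x.
exists v => //; split => // z Az vz; apply/eqP; apply: contraT => z0.
have [w [Aw vw [i wi]]] : exists w, [/\ A *m w = 0, supported (support v) w &
    exists i, w i 0 < 0].
  have [i zi] : exists i, z i 0 != 0.
    apply/existsP; apply: contraT; rewrite negb_exists => /forallP h.
    case/negP: z0; apply/eqP/matrixP => i j; rewrite ord1 mxE; apply/eqP.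
    by have := h i; rewrite negbK.
  have [zlt|zge] := ltrP (z i 0) 0; first by exists z; split => //; exists i.
  exists (- z); split; first by rewrite mulmxN Az oppr0.
    by move=> j sj; rewrite mxE vz ?oppr0.
  by exists i; rewrite mxE oppr_lt0 lt_neqAle eq_sym zi zge.
have cw : dotp c w = 0.
  have [t t0 [h1 h2]] := kernel_step vb Aw vw.
  apply/eqP; rewrite eq_le; apply/andP; split.
    by have := vmin _ h2; rewrite dotpBr lerBrDr gerDl dotpZr pmulr_rle0.
  by have := vmin _ h1; rewrite dotpDr lerDl dotpZr pmulr_rge0.
have [t t0 [tb tsupp]] := shrink_support vb Aw vw (ex_intro _ i wi).
have /Tmin /(_ (proper_sub tsupp)) E : P (support (v + t *: w)).
  apply/asboolP; exists (v + t *: w) => //; split => // y yb.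
  by rewrite dotpDr dotpZr cw mulr0 addr0 vmin.
by move: tsupp; rewrite E fintype.properxx.
Qed.

End BasicSolutions.

(** * Kernel bases and complementary minors *)

Section KernelBasis.
Variables (R : realType) (d n : nat) (A : 'M[R]_(d, n)) (B : 'M[R]_(n, n - d)).
Hypotheses (A_rank : \rank A = d) (B_ker : is_ker_basis A B).

Local Notation m := (n - d)%N.

Lemma leq_rank_dim : (d <= n)%N.
Proof. by rewrite -A_rank rank_leq_col. Qed.

Lemma mulmx_kerB : A *m B = 0.
Proof.
have [_ BA] := B_ker; apply: trmx_inj; rewrite trmx_mul trmx0.
by apply/sub_kermxP; rewrite BA.
Qed.

Lemma kerB_param (x : 'cV[R]_n) : A *m x = 0 -> exists t, x = B *m t.
Proof.
move=> Ax; have [_ BA] := B_ker.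
have : (x^T <= B^T)%MS by rewrite BA; apply/sub_kermxP; rewrite -trmx_mul Ax trmx0.
by move=> /submxP[t xt]; exists t^T; apply: trmx_inj; rewrite trmx_mul trmxK.
Qed.

Lemma mulB_inj (t : 'cV[R]_m) : B *m t = 0 -> t = 0.
Proof.
move=> Bt; have [Bf _] := B_ker; apply: trmx_inj; apply/eqP.
by rewrite trmx0 -(mulmx_free_eq0 _ Bf) -trmx_mul Bt trmx0.
Qed.

Lemma unitmx_of_inj k (M : 'M[R]_k) :
  (forall t : 'cV[R]_k, M *m t = 0 -> t = 0) -> M \in unitmx.
Proof.
move=> Mi; rewrite -unitmx_tr -row_free_unit -kermx_eq0.
apply/eqP/row_matrixP => i; rewrite row0; apply: trmx_inj; rewrite trmx0.
apply: Mi; apply: trmx_inj; rewrite trmx_mul trmxK trmx0.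
by apply/sub_kermxP; exact: row_sub.
Qed.

Lemma sqr_norm_eq0 k (x : 'cV[R]_k) : x^T *m x = 0 -> x = 0.
Proof.
move=> /matrixP /(_ 0 0); rewrite mxE [RHS]mxE => /eqP.
rewrite psumr_eq0; last by move=> i _; rewrite mxE -expr2 sqr_ge0.
move=> /allP h; apply/matrixP => i j; rewrite ord1 mxE.
by have := h i (mem_index_enum _); rewrite implyTb mxE -expr2 sqrf_eq0 => /eqP.
Qed.

Lemma gramB_unit : B^T *m B \in unitmx.
Proof.
apply: unitmx_of_inj => t Bt; apply: mulB_inj; apply: sqr_norm_eq0.
by rewrite trmx_mul -mulmxA [X in _ *m X]mulmxA Bt mulmx0.
Qed.

Local Notation mn := (leq_subr d n).
Local Notation dn := leq_rank_dim.

Definition kersub (I : {set 'I_n}) : 'M[R]_m := rowsub (index_of mn I) B.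

Lemma kersub_coord I (t : 'cV[R]_m) j : (kersub I *m t) j 0 = (B *m t) (index_of mn I j) 0.
Proof. by rewrite !mxE; apply: eq_bigr => k _; rewrite mxE. Qed.

Lemma mulmx_reindex p q r k (h : 'I_k -> 'I_p) (M : 'M[R]_(q, p)) (N : 'M[R]_(p, r)) :
  bijective h -> colsub h M *m rowsub h N = M *m N.
Proof.
move=> hb; apply/matrixP => i j; rewrite !mxE (reindex h) /=; last exact: onW_bij.
by apply: eq_bigr => l _; rewrite !mxE.
Qed.

Lemma absdet_index_of (J : {set 'I_n}) : #|J| = d ->
  absdet A J = `|\det (colsub (index_of dn J) A)|.
Proof.
move=> Jd; rewrite /absdet; congr (`|\det _|).
have conformE k (M : 'M[R]_(d, k)) (h : k = d) :
    conform_mx (0 : 'M[R]_d) M = castmx (erefl, h) M.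
  by subst k; rewrite conform_mx_id castmx_id.
rewrite (conformE _ _ Jd); apply/matrixP => i j; rewrite castmxE !mxE /=.
rewrite cast_ord_id (enum_val_nth (index_of dn J j)) /index_of /=.
congr (A _ _); apply: set_nth_default.
by rewrite -cardE Jd.
Qed.

Lemma dimE : (d + m)%N = n. Proof. exact: subnKC leq_rank_dim. Qed.

(** The square matrix with [A] above [B^T], its columns taken in the order [h]. Its size [d + m] is
    only provably equal to [n], and the order lets a chosen set of [d] columns come first. *)
Definition stacked_mx (h : 'I_(d + m) -> 'I_n) : 'M[R]_(d + m) :=
  col_mx (colsub h A) (rowsub h B)^T.

Lemma det_stacked_mx h : injective h ->
  `|\det (stacked_mx h)| = `|\det (stacked_mx (cast_ord dimE))|.
Proof.
move=> hi; have si : injective (cast_ord (esym dimE) \o h).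
  by move=> i j /cast_ord_inj /hi.
rewrite (_ : stacked_mx h = col_perm (perm si) (stacked_mx (cast_ord dimE))).
  rewrite col_permE det_mulmx normrM det_perm normrX normrN1 expr1n mulr1.
  by [].
apply/matrixP => i j; rewrite !mxE; case: splitP => k _; rewrite !mxE permE /=;
  by rewrite cast_ordKV.
Qed.

(** A vector killed by the stack lies in the kernel of [A], which is the column space of [B], and is
    orthogonal to that space. *)
Lemma stacked_mx_unit : stacked_mx (cast_ord dimE) \in unitmx.
Proof.
set h := cast_ord dimE.
have hb : bijective h by exists (cast_ord (esym dimE)); [exact: cast_ordK|exact: cast_ordKV].
apply: unitmx_of_inj => t; rewrite mul_col_mx => /eqP; rewrite col_mx_eq0 => /andP[].
have tE : t = rowsub h (rowsub (cast_ord (esym dimE)) t).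
  by apply/matrixP => i j; rewrite !mxE cast_ordK.
set x := rowsub (cast_ord (esym dimE)) t in tE.
have -> : (rowsub h B)^T = colsub h B^T by apply/matrixP => i j; rewrite !mxE.
rewrite tE !mulmx_reindex // => /eqP /kerB_param[s xs]; rewrite xs mulmxA => /eqP Bs.
suff -> : s = 0 by rewrite mulmx0; apply/matrixP => i j; rewrite !mxE.
by rewrite -[s](mulKmx gramB_unit) Bs mulmx0.
Qed.

(* Both sides compute the determinant of [A; B^T] [E_J, B], where E_J embeds
   the coordinates outside I: this product is block triangular. *)
Lemma absdet_kersub (I : {set 'I_n}) : #|I| = m ->
  absdet A (~: I)%SET * `|\det (B^T *m B)| =
  `|\det (stacked_mx (cast_ord dimE))| * `|\det (kersub I)|.
Proof.
move=> Im; have Jd : #|(~: I)%SET| = d.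
  by rewrite cardsCs finset.setCK Im card_ord subKn // leq_rank_dim.
rewrite (absdet_index_of Jd).
set g := index_of dn (~: I)%SET; set e := index_of mn I.
pose h (k : 'I_(d + m)) := match fintype.split k with inl i => g i | inr j => e j end.
have hl i : h (lshift m i) = g i by rewrite /h (unsplitK (inl i)).
have hr j : h (rshift d j) = e j by rewrite /h (unsplitK (inr j)).
have ge i j : g i <> e j.
  move=> gej; have := index_of_in dn Jd i; rewrite -/g gej inE.
  by rewrite (index_of_in mn Im).
have hi : injective h.
  move=> i j; rewrite -(splitK i) -(splitK j).
  case: (fintype.split i) (fintype.split j) => [i'|i'] [j'|j'] /=; rewrite ?hl ?hr.
  - by move/(index_of_inj Jd) ->.
  - by move/ge.
  - by move/esym/ge.
  - by move/(index_of_inj Im) ->.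
have hb : bijective h.
  by apply: inj_card_bij => //; rewrite !card_ord dimE.
rewrite -(det_stacked_mx hi) -!normrM; congr `|_|.
have AhE : colsub h A = row_mx (colsub g A) (colsub e A).
  apply/matrixP => i k; rewrite -(splitK k).
  by case: (fintype.split k) => k' /=; rewrite ?row_mxEl ?row_mxEr !mxE ?hl ?hr.
have BhE : rowsub h B = col_mx (rowsub g B) (rowsub e B).
  apply/matrixP => k j; rewrite -(splitK k).
  by case: (fintype.split k) => k' /=; rewrite ?col_mxEu ?col_mxEd !mxE ?hl ?hr.
pose X := block_mx 1%:M (rowsub g B) 0 (rowsub e B) : 'M[R]_(d + m).
have -> : \det (kersub I) = \det X by rewrite det_ublock det1 mul1r.
rewrite -det_mulmx.
have -> : stacked_mx h *m X = block_mx (colsub g A) 0 (rowsub g B)^T (B^T *m B).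
  rewrite /stacked_mx AhE BhE tr_col_mx -/(block_mx _ _ _ _) mulmx_block.
  rewrite !mulmx1 !mulmx0 !addr0; congr block_mx.
    by rewrite -mul_row_col -AhE -BhE mulmx_reindex // mulmx_kerB.
  rewrite -mul_row_col -tr_col_mx -BhE -(mulmx_reindex _ _ hb).
  by congr (_ *m _); apply/matrixP => i j; rewrite !mxE.
by rewrite det_lblock.
Qed.

End KernelBasis.

(** * Vertices and facets over generic points *)

Section VertexStructure.
Variables (R : realType) (d n : nat) (A : 'M[R]_(d, n)) (B : 'M[R]_(n, n - d)).
Hypothesis B_ker : is_ker_basis A B.

Local Notation m := (n - d)%N.
Local Notation mn := (leq_subr d n).
Local Notation zeros v := (~: support v)%SET.

Lemma in_zeros (v : 'cV[R]_n) i : orthant_ge0 v -> (i \in zeros v) = (v i 0 == 0).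
Proof. by move=> v0; rewrite !inE -leNgt eq_le v0 andbT. Qed.

(** Genericity makes the columns on the support span; being basic makes them independent. *)
Lemma basic_card p v : generic A p -> basic A p v -> #|support v| = d.
Proof.
move=> gp [vp vz]; set T := support v.
pose S := \matrix_(i < n, j < #|T|) (i == enum_val j)%:R : 'M[R]_(n, #|T|).
have AS : colsel A T = A *m S.
  apply/matrixP => i j; rewrite !mxE (bigD1 (enum_val j)) //= big1 => [|k kj].
    by rewrite mxE eqxx mulr1 addr0.
  by rewrite mxE (negPf kj) mulr0.
have SS : S^T *m S = 1%:M.
  apply/matrixP => i j; rewrite !mxE (bigD1 (enum_val i)) //= big1 => [|k ki].
    by rewrite !mxE eqxx mul1r addr0 (inj_eq enum_val_inj).
  by rewrite !mxE (negPf ki) mul0r.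
have : row_free (colsel A T).
  rewrite -kermx_eq0; apply/eqP/row_matrixP => k; rewrite row0.
  apply: (gp v vp) => i vi.
  have : row k (kermx (colsel A T)) *m colsel A T = 0 by apply/sub_kermxP; exact: row_sub.
  have iT : i \in T by rewrite inE.
  rewrite AS mulmxA => /matrixP /(_ 0 (enum_rank_in iT i)).
  rewrite mxE [RHS]mxE (bigD1 i) //= big1 ?addr0 => [|j ji].
    by rewrite [X in _ * X]mxE enum_rankK_in // eqxx mulr1.
  by rewrite [X in _ * X]mxE enum_rankK_in // (negPf ji) mulr0.
have : row_free (colsel A T)^T.
  rewrite -kermx_eq0; apply/eqP/row_matrixP => k; rewrite row0.
  set z := row k _.
  have zA : z *m (colsel A T)^T = 0 by apply/sub_kermxP; exact: row_sub.
  have : S *m z^T = 0.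
    apply: vz.
      by rewrite mulmxA -AS; apply: trmx_inj; rewrite trmx_mul trmxK zA trmx0.
    move=> i iT; rewrite mxE big1 // => j _; rewrite mxE.
    case: eqP => [ij|_]; last by rewrite mul0r.
    by rewrite ij enum_valP in iT.
  move=> /(congr1 (mulmx S^T)); rewrite mulmxA SS mul1mx mulmx0 => z0.
  by rewrite -[z]trmxK z0 trmx0.
by rewrite /row_free mxrank_tr => /eqP -> /eqP.
Qed.

Lemma basic_cocard p v : generic A p -> basic A p v -> #|zeros v| = m.
Proof.
move=> gp bv; have := cardsC (support v); rewrite card_ord (basic_card gp bv) => h.
by rewrite -[in RHS]h addKn.
Qed.

Lemma basic_kersub_unit p v : generic A p -> basic A p v ->
  kersub B (zeros v) \in unitmx.
Proof.
move=> gp bv; have vm := basic_cocard gp bv; case: bv => vp vz.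
apply: unitmx_of_inj => t Bt; apply: (mulB_inj B_ker); apply: vz.
  by rewrite mulmxA (mulmx_kerB B_ker) mul0mx.
move=> i; rewrite -finset.in_setC => /(index_of_surj mn vm)[j ->].
by rewrite -kersub_coord Bt mxE.
Qed.

(** The fiber is simple at [v]: the values of a kernel direction on the zero coordinates of [v] can
    be prescribed freely. *)
Lemma basic_direction p v (u : 'cV[R]_m) : generic A p -> basic A p v ->
  exists t : 'cV[R]_m, forall j, (B *m t) (index_of mn (zeros v) j) 0 = u j 0.
Proof.
move=> gp bv; exists (invmx (kersub B (zeros v)) *m u) => j.
by rewrite -kersub_coord mulKVmx // (basic_kersub_unit gp bv).
Qed.

Lemma aff_hull_sub_eq (S : set 'cV[R]_n) k (M : 'M[R]_(k, n)) c :
  S `<=` [set x | M *m x = c] -> aff_hull S `<=` [set x | M *m x = c].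
Proof.
move=> Sc _ [l [q [w [Sq w1 ->]]]] /=; rewrite mulmx_sumr.
rewrite (eq_bigr (fun i => w i *: c)); last first.
  by move=> i _; rewrite -scalemxAr (Sc _ (Sq i)).
by rewrite -scaler_suml w1 scale1r.
Qed.

Lemma aff_hull_fiber p : pos A p -> aff_hull (fiber A p) = [set x | A *m x = p].
Proof.
move=> [q q0 qp]; apply/seteqP; split; first by apply: aff_hull_sub_eq => x [].
move=> x /= xp; have [e e0 estep] := small_step q (x - q).
apply: (@aff_hull_line _ _ _ q x e); first by rewrite gt_eqF.
  by split => // i; exact/ltW/q0.
split; last by rewrite mulmxDr -scalemxAr mulmxBr xp qp subrr scaler0 addr0.
by move=> i; apply/ltW/estep => //; rewrite gtr0_norm.
Qed.

Lemma aff_dim_fiber p : pos A p -> aff_dim (fiber A p) m.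
Proof.
move=> pp; have [q _ qp] := pp; exists q, B; split.
  by have [/eqP] := B_ker; rewrite mxrank_tr.
rewrite aff_hull_fiber //; apply/seteqP; split => [x /= xp|_ [t _ <-]] /=.
  have [t tE] : exists t, x - q = B *m t.
    by apply: (kerB_param B_ker); rewrite mulmxBr xp qp subrr.
  by exists t => //; rewrite -tE addrC subrK.
by rewrite mulmxDr mulmxA (mulmx_kerB B_ker) mul0mx addr0.
Qed.

Section Facet.
Variables (p : 'cV[R]_d) (v : 'cV[R]_n) (i : 'I_n).
Hypotheses (p_pos : pos A p) (p_gen : generic A p) (v_basic : basic A p v).
Hypothesis vi : i \in zeros v.

Let F := fiber A p `&` [set x | x i 0 = 0].

(** Leave [v] along the kernel direction that is 0 at [i] and 1 at the other zero coordinates.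
    Positive coordinates survive a short step and every zero coordinate but [i] becomes positive. *)
Lemma facet_point : exists q, F q /\ forall j, j != i -> 0 < q j 0.
Proof.
have vm := basic_cocard p_gen v_basic; have [[v0 vp] vz] := v_basic.
have [k ik] := index_of_surj mn vm vi.
have [t tE] := basic_direction (\col_j (j != k)%:R) p_gen v_basic.
have [e e0 estep] := small_step v (B *m t).
have qi j : 0 < v j 0 -> 0 < (v + e *: (B *m t)) j 0.
  by move=> vj; apply: estep => //; rewrite gtr0_norm.
have qz l : (v + e *: (B *m t)) (index_of mn (zeros v) l) 0 = e * (l != k)%:R.
  rewrite mxE [X in _ + X]mxE tE mxE.
  by have := index_of_in mn vm l; rewrite in_zeros // => /eqP ->; rewrite add0r.
exists (v + e *: (B *m t)); split; last first.
  move=> j ji; have [vj|vj] := ltrP 0 (v j 0); first exact: qi.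
  have : j \in zeros v by rewrite !inE -leNgt.
  move=> /(index_of_surj mn vm)[l lE]; rewrite lE qz.
  have -> : l != k by apply: contra ji => /eqP lk; rewrite lE lk ik.
  by rewrite mulr1.
split; last by rewrite /= ik qz eqxx mulr0.
split; last by rewrite mulmxDr -scalemxAr mulmxA (mulmx_kerB B_ker) mul0mx scaler0 addr0.
move=> j; have [vj|vj] := ltrP 0 (v j 0); first exact/ltW/qi.
have : j \in zeros v by rewrite !inE -leNgt.
move=> /(index_of_surj mn vm)[l ->]; rewrite qz.
by apply: mulr_ge0; [exact: ltW|exact: ler0n].
Qed.

Lemma aff_hull_facet : aff_hull F = [set x | A *m x = p /\ x i 0 = 0].
Proof.
have [q [[[q0 qp] qi] qpos]] := facet_point.
apply/seteqP; split => x.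
  move=> xF; split.
    by apply: (@aff_hull_sub_eq F d A p) xF => y [[]].
  have := @aff_hull_sub_eq F 1 (delta_mx 0 i) 0.
  have dE (y : 'cV[R]_n) : (delta_mx 0 i : 'rV_n) *m y = 0 <-> y i 0 = 0.
    rewrite -rowE; split=> [/matrixP /(_ 0 0)|yi]; first by rewrite !mxE.
    by apply/matrixP => a b; rewrite !ord1 !mxE.
  by move=> /(_ _) h; apply/dE; apply: h xF => y [_ /dE].
move=> [xp xi]; have [e e0 estep] := small_step q (x - q).
apply: (@aff_hull_line _ _ _ q x e); first by rewrite gt_eqF.
  by split.
have Ei : (q + e *: (x - q)) i 0 = 0 by rewrite !mxE xi qi subrr mulr0 addr0.
split => //; split; last by rewrite mulmxDr -scalemxAr mulmxBr xp qp subrr scaler0 addr0.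
move=> j; have [->|ji] := eqVneq j i; first by rewrite Ei.
by apply/ltW/estep; rewrite ?gtr0_norm ?qpos.
Qed.

Lemma zeros_dim_gt0 : (0 < m)%N.
Proof. by rewrite -(basic_cocard p_gen v_basic) card_gt0; apply/set0Pn; exists i. Qed.

Lemma row_kerB_neq0 : row i B != 0.
Proof.
have vm := basic_cocard p_gen v_basic.
have [k ik] := index_of_surj mn vm vi.
have [t tE] := basic_direction (const_mx 1) p_gen v_basic.
apply/eqP => rB; have := tE k; rewrite -ik.
have -> : (B *m t) i 0 = (row i B *m t) 0 0.
  by rewrite !mxE; apply: eq_bigr => j _; rewrite mxE.
by rewrite rB mul0mx !mxE => /esym/eqP; rewrite oner_eq0.
Qed.

(** The directions of [F] are the images under [B] of the vectors orthogonal to row [i] of [B], a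
    hyperplane because that row is nonzero. *)
Lemma aff_dim_facet : aff_dim F m.-1.
Proof.
have [q [[[q0 qp] qi] _]] := facet_point.
set K := kermx (row i B)^T.
have Bf : row_free B^T by case: B_ker.
have rK : \rank K = m.-1.
  by rewrite mxrank_ker mxrank_tr rank_rV row_kerB_neq0 subn1.
rewrite -rK; exists q, (B *m (row_base K)^T); split.
  by rewrite -mxrank_tr trmx_mul trmxK mxrankMfree // (eq_row_base K).
rewrite aff_hull_facet; apply/seteqP; split => [x [xp xi]|_ [s _ <-]].
  have [t tE] : exists t, x - q = B *m t.
    by apply: (kerB_param B_ker); rewrite mulmxBr xp qp subrr.
  have : (t^T <= row_base K)%MS.
    rewrite eq_row_base; apply/sub_kermxP; rewrite -trmx_mul -row_mul -tE.
    by apply/matrixP => a b; rewrite !ord1 !mxE xi qi subrr.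
  move=> /submxP[s sE]; exists s^T => //.
  by rewrite -mulmxA -trmx_mul -sE trmxK -tE addrC subrK.
split; first by rewrite mulmxDr !mulmxA (mulmx_kerB B_ker) !mul0mx addr0.
rewrite mxE qi add0r -mulmxA.
have -> : (B *m ((row_base K)^T *m s)) i 0 = (row i B *m ((row_base K)^T *m s)) 0 0.
  by rewrite -row_mul [RHS]mxE.
have : row_base K *m (row i B)^T = 0 by apply/sub_kermxP; rewrite eq_row_base.
move=> /(congr1 trmx); rewrite trmx_mul trmxK trmx0 => E.
by rewrite mulmxA E mul0mx mxE.
Qed.

Lemma zero_facet : is_facet (fiber A p) F.
Proof.
have [q [Fq _]] := facet_point.
split; last first.
  exists m.-1; split; last exact: aff_dim_facet.
  by rewrite prednK ?zeros_dim_gt0 //; exact: aff_dim_fiber.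
split; first by exists q.
exists (- delta_mx i 0), 0.
have dE (x : 'cV[R]_n) : dotp (- delta_mx i 0) x = - x i 0.
  rewrite dotpE (bigD1 i) //= big1 ?addr0 => [|j ji].
    by rewrite !mxE !eqxx mulN1r.
  by rewrite !mxE (negPf ji) oppr0 mul0r.
split; first by move=> x [x0 _]; rewrite dE oppr_le0.
by apply/seteqP; split => x [xp xi]; split => //; move: xi => /=; rewrite dE;
  [move=> ->; rewrite oppr0|move/eqP; rewrite oppr_eq0 => /eqP].
Qed.

End Facet.

Hypotheses (A_ge0 : forall i j, 0 <= A i j) (A_col : forall j, col j A != 0).

(** A generic [b] is itself interior to its chamber, so the choice made by [cell_point] never falls
    back on the default. *)
Lemma cellP C : cells A C -> exists b, [/\ C = chamber A b, cone A b,
  generic A b & C° (cell_point C)].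
Proof.
move=> [[b bA <-] Cd]; have gb := cell_generic Cd.
exists b; split => //; apply: (@xgetPex _ 0 (chamber A b)°).
by exists b; exact: generic_interior.
Qed.

Section Cell.
Variable C : set 'cV[R]_d.
Hypothesis cellC : cells A C.
Local Notation p := (cell_point C).

Lemma cell_point_generic : generic A p.
Proof.
have [b [CE bA gb]] := cellP cellC; rewrite {1}CE => pC.
exact: (interior_chamber_generic A_ge0 A_col bA gb pC).
Qed.

Lemma cell_point_pos : pos A p.
Proof.
have [b [CE bA gb]] := cellP cellC; rewrite {1}CE => pC.
exact: (interior_chamber_pos bA pC).
Qed.

(** The passage goes through [b]: a cone containing the interior point [p] contains [b] by
    [interior_chamber_cone], and then the chamber of [b] by definition. *)
Lemma cell_sub_cone s : cone (colsel A s) p -> C `<=` cone (colsel A s).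
Proof.
move=> sp; have [b [CE bA gb]] := cellP cellC; rewrite {1}CE => pC.
rewrite CE; apply: chamber_sub.
exact: (interior_chamber_cone A_ge0 A_col bA pC sp).
Qed.

Lemma vertex_indices_basic v : basic A p v -> vertex_indices A p v = zeros v.
Proof.
move=> vb; apply/setP => i; rewrite inE.
have [[v0 _] _] := vb; rewrite -in_zeros //.
have [vi|] := boolP (i \in zeros v); last by rewrite andbF.
rewrite andbT inE; apply/asboolP.
exact: (zero_facet cell_point_pos cell_point_generic vb vi).
Qed.

Lemma mem_VC I : I \in VC A C <-> exists2 v, basic A p v & I = zeros v.
Proof.
rewrite inE; split=> [/asboolP[v [/vertex_basic vb ->]]|[v vb ->]].
  by exists v => //; rewrite vertex_indices_basic.
apply/asboolP; exists v; split; first exact: basic_vertex.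
by rewrite vertex_indices_basic.
Qed.

Lemma VC_sub_FC I : I \in VC A C -> I \subset FC A C.
Proof.
rewrite inE => /asboolP[v [_ ->]]; apply/fintype.subsetP => i.
by rewrite inE => /andP[].
Qed.

Lemma VC_card I : I \in VC A C -> #|I| = m.
Proof. by move=> /mem_VC[v vb ->]; exact: basic_cocard cell_point_generic vb. Qed.

Lemma VC_unit I : I \in VC A C -> kersub B I \in unitmx.
Proof. by move=> /mem_VC[v vb ->]; exact: basic_kersub_unit cell_point_generic vb. Qed.

(** Distinct vertices over [p] may merge over a boundary point, but the columns outside [I] still
    represent [b], by [cell_sub_cone]. *)
Lemma VC_vertex I b : I \in VC A C -> C b ->
  exists2 v, fiber A b v & forall i, i \in I -> v i 0 = 0.
Proof.
move=> /mem_VC[v vb ->] bC.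
have /cell_sub_cone /(_ b bC) : cone (colsel A (support v)) p.
  by apply: cone_support; case: vb.
move=> /cone_colselP[w [w0 ws wb]]; exists w => // i.
by rewrite finset.in_setC => /ws.
Qed.

End Cell.
End VertexStructure.

(** * Volume of the polar *)

Section PolarVolume.
Variables (R : realType) (d n : nat) (A : 'M[R]_(d, n)) (B : 'M[R]_(n, n - d)).
Hypotheses (A_rank : \rank A = d) (B_ker : is_ker_basis A B).
Hypotheses (A_ge0 : forall i j, 0 <= A i j) (A_col : forall j, col j A != 0).

Local Notation m := (n - d)%N.
Local Notation mn := (leq_subr d n).
Local Notation zeros v := (~: support v)%SET.

(* The coefficients of B^T B z over the rows of -B indexed by I. *)
Definition normal_coef (I : {set 'I_n}) (z : 'cV[R]_m) : 'cV[R]_m :=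
  - (invmx (kersub B I)^T *m (B^T *m B *m z)).

(** Multiplies each normal coefficient of [z] by the matching coordinate of [x], so that the simplex
    attached to [I] is the preimage of the standard one. *)
Definition normal_mx (I : {set 'I_n}) (x : 'cV[R]_n) : 'M[R]_m :=
  diag_mx (\row_j x (index_of mn I j) 0) *m - (invmx (kersub B I)^T *m (B^T *m B)).

Lemma normal_mxE I x z j :
  (normal_mx I x *m z) j 0 = x (index_of mn I j) 0 * normal_coef I z j 0.
Proof.
rewrite /normal_mx -mulmxA mul_diag_mx [LHS]mxE [in LHS]mxE; congr (_ * _).
by rewrite /normal_coef mulNmx !mulmxA.
Qed.

Lemma dotpC k (u v : 'cV[R]_k) : dotp u v = dotp v u.
Proof. by rewrite !dotpE; apply: eq_bigr => i _; rewrite mulrC. Qed.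

Lemma dotp_kerB (z : 'cV[R]_m) (x y : 'cV[R]_n) :
  dotp (B^T *m y - B^T *m x) z = dotp (B *m z) (y - x).
Proof.
by rewrite -mulmxBr dotpC /dotp trmx_mul mulmxA.
Qed.

(** With [y - x = B *m t] the pairing is that of [t] with [B^T *m B *m z], expanded over the rows of
    [kersub B I]. For nonnegative coefficients it is largest over the fiber where [y] vanishes on
    [I], so one inequality decides membership in the polar. *)
Lemma polar_pairing I z x y : kersub B I \in unitmx -> A *m x = A *m y ->
  dotp (B *m z) (y - x) = \sum_j normal_coef I z j 0 *
    (x (index_of mn I j) 0 - y (index_of mn I j) 0).
Proof.
move=> Ku xy.
have [t tE] : exists t, y - x = B *m t.
  by apply: (kerB_param B_ker); rewrite mulmxBr xy subrr.
have zE : (B *m z)^T *m B = - (normal_coef I z)^T *m kersub B I.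
  apply: trmx_inj; rewrite [LHS]trmx_mul trmxK [RHS]trmx_mul raddfN /= trmxK.
  by rewrite /normal_coef opprK mulKVmx ?unitmx_tr // mulmxA.
rewrite /dotp tE mulmxA zE -mulmxA mulNmx mxE mxE -sumrN; apply: eq_bigr => j _.
by rewrite [X in X * _]mxE kersub_coord -tE !mxE -mulrN opprB.
Qed.

Section Cell.
Variable C : set 'cV[R]_d.
Hypothesis cellC : cells A C.
Local Notation p := (cell_point C).

(** A vertex [v] over [p] that maximises the pairing with [B *m z] supplies [I]. Along the edge that
    frees only the [j]-th zero coordinate of [v], the pairing changes by a negative multiple of the
    [j]-th coefficient. *)
Lemma normal_cover z : exists2 I, I \in VC A C & forall j, 0 <= normal_coef I z j 0.
Proof.
have pgen := cell_point_generic A_ge0 A_col cellC.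
have [|v vb vmin] := @basic_argmin _ _ _ A A_ge0 A_col p (- (B *m z)).
  by have [q q0 qp] := cell_point_pos cellC; exists q; split => // i; exact: ltW.
exists (zeros v); first by apply/(mem_VC B_ker A_ge0 A_col cellC); exists v.
have vm := basic_cocard pgen vb.
have Ku := basic_kersub_unit B_ker pgen vb.
move=> j; have [t tE] := basic_direction B_ker (delta_mx j 0) pgen vb.
have [e e0 estep] := small_step v (B *m t).
have [[v0 vp] vz] := vb.
set y := v + e *: (B *m t).
have yE l : y (index_of mn (zeros v) l) 0 = e * (l == j)%:R.
  rewrite mxE [X in _ + X]mxE tE mxE eqxx andbT.
  by have := index_of_in mn vm l; rewrite in_zeros // => /eqP ->; rewrite add0r.
have yp : A *m y = p.
  by rewrite mulmxDr -scalemxAr mulmxA (mulmx_kerB B_ker) // mul0mx scaler0 addr0.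
have yf : fiber A p y.
  split => // i; have [vi|vi] := ltrP 0 (v i 0).
    by apply/ltW/estep => //; rewrite gtr0_norm.
  have : i \in zeros v by rewrite !inE -leNgt.
  move=> /(index_of_surj mn vm)[l ->]; rewrite yE.
  by apply: mulr_ge0; [exact: ltW|exact: ler0n].
have : dotp (B *m z) (y - v) <= 0.
  have := vmin y yf; rewrite /dotp linearN /= !mulNmx mxE [X in _ <= X]mxE lerN2 => h.
  by rewrite mulmxBr mxE [X in _ + X]mxE subr_le0.
rewrite (polar_pairing _ Ku) ?yp // (bigD1 j) //= big1 ?addr0 => [|l lj]; last first.
  have := index_of_in mn vm l; rewrite in_zeros // => /eqP ->.
  by rewrite yE (negPf lj) mulr0 subrr mulr0.
have := index_of_in mn vm j; rewrite in_zeros // => /eqP ->.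
by rewrite yE eqxx mulr1 sub0r mulrN oppr_le0 pmulr_lge0.
Qed.

(** For the two vertices [v] and [w], the pairing with [w - v] is nonpositive by the cone of [I] and
    nonnegative by that of [J], hence 0. Strict positivity on [I] makes [w] vanish on [I], and the
    basic point [v] is the only such point of its fiber. *)
Lemma normal_cones_disjoint I J z : I \in VC A C -> J \in VC A C ->
  (forall j, 0 < normal_coef I z j 0) -> (forall j, 0 < normal_coef J z j 0) -> I = J.
Proof.
have mem := mem_VC B_ker A_ge0 A_col cellC.
have pgen := cell_point_generic A_ge0 A_col cellC.
move=> /[dup] IV /mem[v vb IE] /[dup] JV /mem[w wb JE] zI zJ.
have [[v0 vp] vz] := vb; have [[w0 wp] wz] := wb.
have vI := VC_card B_ker A_ge0 A_col cellC IV.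
have wJ := VC_card B_ker A_ge0 A_col cellC JV.
have hI : dotp (B *m z) (w - v) =
    - \sum_j normal_coef I z j 0 * w (index_of mn I j) 0.
  rewrite (polar_pairing (I := I)) ?wp ?vp // ?(VC_unit B_ker A_ge0 A_col cellC) //.
  rewrite -sumrN; apply: eq_bigr => j _; have := index_of_in mn vI j.
  by rewrite {2}IE in_zeros // => /eqP ->; rewrite sub0r mulrN.
have hJ : dotp (B *m z) (v - w) =
    - \sum_j normal_coef J z j 0 * v (index_of mn J j) 0.
  rewrite (polar_pairing (I := J)) ?wp ?vp // ?(VC_unit B_ker A_ge0 A_col cellC) //.
  rewrite -sumrN; apply: eq_bigr => j _; have := index_of_in mn wJ j.
  by rewrite {2}JE in_zeros // => /eqP ->; rewrite sub0r mulrN.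
have sI : 0 <= \sum_j normal_coef I z j 0 * w (index_of mn I j) 0.
  by apply: sumr_ge0 => j _; rewrite mulr_ge0 // ltW.
have sJ : 0 <= \sum_j normal_coef J z j 0 * v (index_of mn J j) 0.
  by apply: sumr_ge0 => j _; rewrite mulr_ge0 // ltW.
have s0 : \sum_j normal_coef I z j 0 * w (index_of mn I j) 0 = 0.
  have : dotp (B *m z) (v - w) = - dotp (B *m z) (w - v) by rewrite -dotpNr opprB.
  by rewrite hI hJ opprK => h; apply/eqP; rewrite eq_le sI andbT -h oppr_le0.
have wI i : i \in I -> w i 0 = 0.
  move=> /(index_of_surj mn vI)[j ->]; move/eqP: s0.
  rewrite psumr_eq0; last by move=> k _; rewrite mulr_ge0 // ltW.
  move=> /allP /(_ j (mem_index_enum _)).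
  by rewrite implyTb mulf_eq0 gt_eqF //= => /eqP.
suff wv : w = v by rewrite IE JE wv.
apply/eqP; rewrite -subr_eq0; apply/eqP/vz; first by rewrite mulmxBr wp vp subrr.
move=> i; rewrite -finset.in_setC => iz; rewrite mxE wI ?IE // add0r mxE.
by move: iz; rewrite in_zeros // => /eqP ->; rewrite oppr0.
Qed.

Definition inv_weight (x : 'cV[R]_n) : R :=
  \sum_(I in VC A C) absdet A (~: I)%SET / \prod_(i in I) x i 0.

Lemma normal_mx_unit I x : I \in VC A C -> orthant_pos x -> normal_mx I x \in unitmx.
Proof.
move=> IV x0; rewrite unitmx_mul; apply/andP; split.
  rewrite unitmxE det_diag unitfE; apply/prodf_neq0 => j _.
  by rewrite mxE gt_eqF.
rewrite unitmxE -scaleN1r detZ unitrMl ?unitrX ?unitrN1 // -unitmxE.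
rewrite unitmx_mul unitmx_inv unitmx_tr.
by rewrite (VC_unit B_ker A_ge0 A_col cellC) // (gramB_unit B_ker).
Qed.

Local Notation stack := (stacked_mx A B (cast_ord (dimE A_rank))).

Lemma absdet_VC_gt0 I : I \in VC A C -> 0 < absdet A (~: I)%SET.
Proof.
move=> IV; have := absdet_kersub A_rank B_ker (VC_card B_ker A_ge0 A_col cellC IV).
have K0 : 0 < `|\det (kersub B I)|.
  by rewrite normr_gt0 -unitfE -unitmxE (VC_unit B_ker A_ge0 A_col cellC).
have S0 : 0 < `|\det stack|.
  by rewrite normr_gt0 -unitfE -unitmxE (stacked_mx_unit A_rank B_ker).
have G0 : 0 < `|\det (B^T *m B)|.
  by rewrite normr_gt0 -unitfE -unitmxE (gramB_unit B_ker).
by move=> h; rewrite -(pmulr_lgt0 _ G0) h mulr_gt0.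
Qed.

(** [absdet_kersub] trades the minor of [B] for the complementary minor of [A]. The Gram determinant
    cancels, and what remains besides the weight does not depend on [I]. *)
Lemma det_normal_mx I x : I \in VC A C -> orthant_pos x ->
  `|\det (normal_mx I x)|^-1 =
  `|\det stack|^-1 * (absdet A (~: I)%SET / \prod_(i in I) x i 0).
Proof.
move=> IV x0; have vI := VC_card B_ker A_ge0 A_col cellC IV.
have := absdet_kersub A_rank B_ker vI.
have K0 : 0 < `|\det (kersub B I)|.
  by rewrite normr_gt0 -unitfE -unitmxE (VC_unit B_ker A_ge0 A_col cellC).
have S0 : 0 < `|\det stack|.
  by rewrite normr_gt0 -unitfE -unitmxE (stacked_mx_unit A_rank B_ker).
have G0 : 0 < `|\det (B^T *m B)|.
  by rewrite normr_gt0 -unitfE -unitmxE (gramB_unit B_ker).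
rewrite /normal_mx det_mulmx normrM det_diag -scaleN1r detZ normrM normrX normrN1 expr1n mul1r.
rewrite det_mulmx det_inv det_tr normrM normrV ?unitfE -?normr_gt0 //.
have -> : \prod_i (\row_j x (index_of mn I j) 0) 0 i = \prod_(i in I) x i 0.
  by rewrite (big_index_of mn vI); apply: eq_bigr => j _; rewrite mxE.
have P0 : 0 < \prod_(i in I) x i 0 by apply: prodr_gt0.
rewrite (gtr0_norm P0) => h.
move: K0 S0 G0 P0 h; set k := `|\det (kersub B I)|; set s := `|\det stack|.
set g := `|\det (B^T *m B)|; set q := \prod_(i in I) _; set a := absdet _ _.
move=> K0 S0 G0 P0 h.
have -> : a = s * k / g by rewrite -h mulfK // gt_eqF.
by field; rewrite !gt_eqF.
Qed.

Definition polar_const : R := simplex_vol R m / `|\det stack|.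

Lemma polar_const_gt0 : 0 < polar_const.
Proof.
apply: divr_gt0; first exact: simplex_vol_gt0.
by rewrite normr_gt0 -unitfE -unitmxE (stacked_mx_unit A_rank B_ker).
Qed.

Theorem vol_polar x : orthant_pos x -> C (A *m x) ->
  vol (polar_at (Qpoly A B (A *m x)) (B^T *m x)) = (polar_const * inv_weight x)%:E.
Proof.
move=> x0 xC.
rewrite (@vol_simplicial_union R m _ (mem (VC A C)) (fun I => normal_mx I x)).
- congr (_%:E); rewrite /polar_const /inv_weight -mulrA mulr_sumr; congr (_ * _).
  by apply: eq_bigr => I IV; exact: det_normal_mx.
- by move=> I IV; exact: normal_mx_unit.
- move=> z; split.
    move=> zpol; have [I IV zI] := normal_cover z; exists I => //.
    have Ku := VC_unit B_ker A_ge0 A_col cellC IV.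
    have vI := VC_card B_ker A_ge0 A_col cellC IV.
    split=> [j|]; first by rewrite normal_mxE mulr_ge0 // ltW.
    (* Testing [z] on this point of the fiber gives exactly the inequality of the simplex. *)
    have [v vb vz] := VC_vertex B_ker A_ge0 A_col cellC IV xC.
    have : Qpoly A B (A *m x) (B^T *m v) by exists v.
    move=> /zpol; rewrite dotp_kerB (polar_pairing _ Ku); last by case: vb.
    rewrite (eq_bigr (fun j => (normal_mx I x *m z) j 0)) // => j _.
    by rewrite normal_mxE vz ?index_of_in // subr0 mulrC.
  move=> [I IV [zI zI1]] _ [y [y0 yb] <-].
  have Ku := VC_unit B_ker A_ge0 A_col cellC IV.
  rewrite dotp_kerB (polar_pairing _ Ku) //.
  apply: le_trans zI1; apply: ler_sum => j _.
  rewrite normal_mxE mulrC ler_wpM2r //; last by rewrite gerBl.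
  by have := zI j; rewrite normal_mxE pmulr_rge0.
- move=> I J z IV JV [zI _] [zJ _]; apply: (normal_cones_disjoint (z := z) IV JV) => j.
    by have := zI j; rewrite normal_mxE pmulr_rgt0.
  by have := zJ j; rewrite normal_mxE pmulr_rgt0.
Qed.


End Cell.
End PolarVolume.

(** * Santalo points and patches *)

Section Minimiser.
Variables (R : realType) (d n : nat) (A : 'M[R]_(d, n)) (B : 'M[R]_(n, n - d)).
Hypotheses (A_rank : \rank A = d) (B_ker : is_ker_basis A B).
Hypotheses (A_ge0 : forall i j, 0 <= A i j) (A_col : forall j, col j A != 0).

Local Notation m := (n - d)%N.
Local Notation mn := (leq_subr d n).

(** The product is [expR] of the sum of the [- ln (r i)]. Two tangent inequalities combine:
    [1 - r <= - ln r], which provides strictness, and [1 + s <= expR s]. It is applied to the ratios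
    of the coordinates of two points. *)
Lemma prodV_tangent (I : {set 'I_n}) (r : 'I_n -> R) :
  (forall i, i \in I -> 0 < r i) ->
  1 + \sum_(i in I) (1 - r i) <= \prod_(i in I) (r i)^-1 /\
  ((exists2 i, i \in I & r i != 1) ->
   1 + \sum_(i in I) (1 - r i) < \prod_(i in I) (r i)^-1).
Proof.
move=> r0.
have prodE : \prod_(i in I) (r i)^-1 = expR (\sum_(i in I) - ln (r i)).
  rewrite expR_sum; apply: eq_bigr => i iI.
  by rewrite expRN lnK // posrE r0.
have lnr i : i \in I -> 1 - r i <= - ln (r i).
  move=> iI; have := expR_ge1Dx (ln (r i)); rewrite lnK ?posrE ?r0 //; lra.
have lnr_lt i : i \in I -> r i != 1 -> 1 - r i < - ln (r i).
  move=> iI ri; have := @expR_gt1Dx _ (ln (r i)); rewrite lnK ?posrE ?r0 //.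
  have -> : ln (r i) != 0 by rewrite ln_eq0 // r0.
  move=> /(_ isT); lra.
rewrite prodE; split.
  apply: le_trans (expR_ge1Dx _) _; rewrite ler_expR; exact: ler_sum.
move=> [i iI ri]; apply: le_lt_trans (expR_ge1Dx _) _; rewrite ltr_expR.
rewrite (bigD1 i) //= [ltRHS](bigD1 i) //=.
apply: ltr_leD; first exact: lnr_lt.
by apply: ler_sum => j /andP[jI _]; exact: lnr.
Qed.

Section Cell.
Variable C : set 'cV[R]_d.
Hypothesis cellC : cells A C.
Local Notation f := (inv_weight A C).

(* Minus the derivative of inv_weight at x in the direction u. *)
Definition weight_slope (x u : 'cV[R]_n) : R :=
  \sum_(I in VC A C) absdet A (~: I)%SET / \prod_(i in I) x i 0 *
    \sum_(i in I) u i 0 / x i 0.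

Let absdet_gt0 I : I \in VC A C -> 0 < absdet A (~: I)%SET.
Proof. exact: (absdet_VC_gt0 A_rank B_ker A_ge0 A_col cellC). Qed.

Let VC_witness : exists I, I \in VC A C.
Proof. by have [I IV _] := normal_cover B_ker A_ge0 A_col cellC 0; exists I. Qed.

Lemma VC_separates I (x y : 'cV[R]_n) : I \in VC A C -> A *m x = A *m y ->
  (forall i, i \in I -> x i 0 = y i 0) -> x = y.
Proof.
move=> IV xy xyI; have vI := VC_card B_ker A_ge0 A_col cellC IV.
have [t tE] : exists t, x - y = B *m t.
  by apply: (kerB_param B_ker); rewrite mulmxBr xy subrr.
suff t0 : t = 0 by apply/eqP; rewrite -subr_eq0 tE t0 mulmx0.
rewrite -[t](mulKmx (VC_unit B_ker A_ge0 A_col cellC IV)).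
have -> : kersub B I *m t = 0; last by rewrite mulmx0.
apply/matrixP => j k; rewrite ord1 kersub_coord -tE !mxE xyI ?subrr //.
exact: index_of_in.
Qed.

Lemma term_tangent I (x y : 'cV[R]_n) : I \in VC A C -> orthant_pos x -> orthant_pos y ->
  let a z := absdet A (~: I)%SET / \prod_(i in I) z i 0 in
  let s := a x - a x * \sum_(i in I) (y - x) i 0 / x i 0 in
  s <= a y /\ ((exists2 i, i \in I & x i 0 != y i 0) -> s < a y).
Proof.
move=> IV x0 y0 a s.
have r0 i : i \in I -> 0 < y i 0 / x i 0 by move=> _; rewrite divr_gt0.
have px (z : 'cV[R]_n) : orthant_pos z -> 0 < \prod_(i in I) z i 0.
  by move=> z0; exact: prodr_gt0.
have ax : 0 < a x by rewrite divr_gt0 ?absdet_gt0 ?px.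
have sE : s = a x * (1 + \sum_(i in I) (1 - y i 0 / x i 0)).
  rewrite mulrDr mulr1 /s; congr (_ + _); rewrite -mulrN -sumrN; congr (_ * _).
  apply: eq_bigr => i _; rewrite !mxE; field; by rewrite gt_eqF.
have ayE : a y = a x * \prod_(i in I) (y i 0 / x i 0)^-1.
  rewrite /a -mulrA; congr (_ * _).
  rewrite -!prodfV -big_split /=; apply: eq_bigr => i _.
  by field; rewrite !gt_eqF.
have [h1 h2] := prodV_tangent r0; rewrite sE ayE; split; first by rewrite ler_pM2l.
move=> [i iI xyi]; rewrite ltr_pM2l //; apply: h2; exists i => //.
by apply: contra xyi => /eqP /divr1_eq ->.
Qed.

(** Each term obeys the tangent inequality. The coordinates in a single [I] of [VC A C] determine a
    point within its fiber, so for [x != y] the term of that [I] is strict. *)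
Lemma weight_tangent x y : orthant_pos x -> orthant_pos y -> A *m x = A *m y ->
  f x - weight_slope x (y - x) <= f y /\
  (x != y -> f x - weight_slope x (y - x) < f y).
Proof.
move=> x0 y0 xy.
have -> : f x - weight_slope x (y - x) = \sum_(I in VC A C)
    (absdet A (~: I)%SET / \prod_(i in I) x i 0 -
     absdet A (~: I)%SET / \prod_(i in I) x i 0 *
       \sum_(i in I) (y - x) i 0 / x i 0).
  by rewrite /inv_weight /weight_slope -sumrB.
split.
  by apply: ler_sum => I IV; have [] := term_tangent IV x0 y0.
move=> xny; have [I IV] := VC_witness.
rewrite (bigD1 I) //= /inv_weight [ltRHS](bigD1 I) //=.
apply: ltr_leD; last first.
  by apply: ler_sum => J /andP[JV _]; have [] := term_tangent JV x0 y0.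
have [_] := term_tangent IV x0 y0; apply.
apply/exists_inP; apply: contraNT xny; rewrite negb_exists_in => /forall_inP h.
apply/eqP; apply: (VC_separates IV xy) => i iI.
by apply/eqP; rewrite -[_ == _]negbK h.
Qed.

Lemma critical_minimiser x : orthant_pos x -> (forall t, weight_slope x (B *m t) = 0) ->
  forall y, orthant_pos y -> A *m y = A *m x -> y != x -> f x < f y.
Proof.
move=> x0 crit y y0 yx ynx.
have [t tE] : exists t, y - x = B *m t.
  by apply: (kerB_param B_ker); rewrite mulmxBr yx subrr.
have [_] := weight_tangent x0 y0 (esym yx).
by rewrite tE crit subr0; apply; rewrite eq_sym.
Qed.

Lemma inv_weight_cvg (T : Type) (F : set_system T) (FF : Filter F)
    (g : T -> 'cV[R]_n) x : orthant_pos x -> g @ F --> x ->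
  (fun t => f (g t)) @ F --> f x.
Proof.
move=> x0 gx; apply: cvg_sum => I _; apply: cvgM; first exact: cvg_cst.
apply: cvgV; first by apply/prodf_neq0 => i _; rewrite gt_eqF.
by apply: cvg_prod => i _; exact: coord_cvg.
Qed.

Lemma weight_slope_cvg (T : Type) (F : set_system T) (FF : Filter F)
    (g : T -> 'cV[R]_n) x u : orthant_pos x -> g @ F --> x ->
  (fun t => weight_slope (g t) u) @ F --> weight_slope x u.
Proof.
move=> x0 gx; apply: cvg_sum => I _; apply: cvgM.
  apply: cvgM; first exact: cvg_cst.
  apply: cvgV; first by apply/prodf_neq0 => i _; rewrite gt_eqF.
  by apply: cvg_prod => i _; exact: coord_cvg.
apply: cvg_sum => i _; apply: cvgM; first exact: cvg_cst.
by apply: cvgV; [rewrite gt_eqF|exact: coord_cvg].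
Qed.

Lemma weight_slopeN x u : weight_slope x (- u) = - weight_slope x u.
Proof.
rewrite /weight_slope -sumrN; apply: eq_bigr => I _; rewrite -mulrN -sumrN.
by congr (_ * _); apply: eq_bigr => i _; rewrite mxE mulNr.
Qed.

Lemma weight_slopeZ x u s : weight_slope x (s *: u) = s * weight_slope x u.
Proof.
rewrite /weight_slope mulr_sumr; apply: eq_bigr => I _; rewrite [RHS]mulrCA.
by congr (_ * _); rewrite mulr_sumr; apply: eq_bigr => i _; rewrite mxE mulrA.
Qed.

(** Were the slope at [x] positive in direction [u], it would by continuity be positive at
    [y = x + s *: u] for small [s]. The tangent plane at [y], evaluated at [x], then gives
    [f y < f x]. Replacing [t] by [- t] gives the other sign. *)
Lemma minimiser_critical x : orthant_pos x ->
  (forall y, orthant_pos y -> A *m y = A *m x -> f x <= f y) ->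
  forall t, weight_slope x (B *m t) = 0.
Proof.
move=> x0 xmin.
have le0 t : weight_slope x (B *m t) <= 0.
  set u := B *m t; rewrite leNgt; apply/negP => su.
  have gx : (fun s : R => x + s *: u) @ (0 : R) --> x.
    suff : (fun s : R => x + s *: u) @ (0 : R) --> x + 0 *: u by rewrite scale0r addr0.
    by apply: cvgD; [exact: cvg_cst|apply: cvgZr_tmp; exact: cvg_id].
  have near_pos : \forall s \near (0 : R), 0 < weight_slope (x + s *: u) u.
    apply: (@cvgr_gt _ _ (nbhs (0 : R)) _ (fun s => weight_slope (x + s *: u) u)
      (weight_slope x u)) => //.
    exact: weight_slope_cvg.
  have /nbhs_ballP[e1 /= e10 h1] := near_pos.
  have [e2 e20 h2] := small_step x u.
  pose s := Num.min (e1 / 2) e2.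
  have s0 : 0 < s by rewrite lt_min e20 divr_gt0.
  have y0 : orthant_pos (x + s *: u).
    by move=> i; apply: h2 => //; rewrite gtr0_norm // ge_min lexx orbT.
  have yx : A *m (x + s *: u) = A *m x.
    by rewrite mulmxDr -scalemxAr mulmxA (mulmx_kerB B_ker) mul0mx scaler0 addr0.
  have [+ _] := weight_tangent y0 x0 yx.
  rewrite opprD addrA subrr add0r weight_slopeN weight_slopeZ opprK.
  have : 0 < weight_slope (x + s *: u) u.
    apply: h1; rewrite /ball /= sub0r normrN gtr0_norm //.
    rewrite gt_min; apply/orP; left.
    by rewrite ltr_pdivrMr // ltr_pMr // ltr1n.
  move=> sl; have := xmin _ y0 yx; have := mulr_gt0 s0 sl; lra.
move=> t; apply/eqP; rewrite eq_le le0 /= -oppr_le0 -weight_slopeN -mulmxN.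
exact: le0.
Qed.

End Cell.
End Minimiser.

(** * The Santalo map on a cell: existence, uniqueness, continuity *)

Section SantaloPoint.
Variables (R : realType) (d n : nat) (A : 'M[R]_(d, n)) (B : 'M[R]_(n, n - d)).
Hypotheses (A_rank : \rank A = d) (B_ker : is_ker_basis A B).
Hypotheses (A_ge0 : forall i j, 0 <= A i j) (A_col : forall j, col j A != 0).

Local Notation m := (n - d)%N.
Local Notation mn := (leq_subr d n).

(** If a coordinate of [x] is 0, a short step away from a positive point [q] of the fiber stays in
    the affine hull but makes that coordinate negative. *)
Lemma relint_fiber b x : pos A b ->
  relint (fiber A b) x <-> orthant_pos x /\ A *m x = b.
Proof.
move=> bpos; split=> [[[x0 xb] xnear]|[x0 xb]].
  split => // i; rewrite lt_neqAle x0 andbT eq_sym; apply/eqP => xi.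
  have [q q0 qb] := bpos.
  have [e e0 /(_ e)] := @interior_step _ _ [set y | aff_hull (fiber A b) y -> fiber A b y]
    x (x - q) xnear.
  rewrite gtr0_norm // lexx => /(_ isT); rewrite /mkset aff_hull_fiber //.
  case; first by rewrite /= mulmxDr -scalemxAr mulmxBr xb qb subrr scaler0 addr0.
  move=> /(_ i) + _; rewrite !mxE xi sub0r add0r mulrN oppr_ge0 leNgt.
  by rewrite mulr_gt0.
split; first by split => // i; exact/ltW/x0.
have := near_orthant_pos x0; apply: filterS => y y0.
by rewrite aff_hull_fiber // => yb; split => // i; exact/ltW/y0.
Qed.

Section Cell.
Variable C : set 'cV[R]_d.
Hypothesis cellC : cells A C.
Local Notation f := (inv_weight A C).

Let absdet_gt0 I : I \in VC A C -> 0 < absdet A (~: I)%SET.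
Proof. exact: (absdet_VC_gt0 A_rank B_ker A_ge0 A_col cellC). Qed.

(** A single term of [f] is at most [M], and the factors of its product other than [y i 0] are at
    most [K]. Since [1 <= K], the exponent [n] serves all [I] at once. *)
Lemma weight_lower_bound (M K : R) : 0 < M -> 1 <= K -> exists2 e : R, 0 < e &
  forall y, orthant_pos y -> f y <= M -> (forall i, y i 0 <= K) ->
    forall I i, I \in VC A C -> i \in I -> e <= y i 0.
Proof.
move=> M0 K1; have K0 : 0 < K by apply: lt_le_trans K1.
pose a := \big[Num.min/1]_(I in VC A C) absdet A (~: I)%SET.
have a0 : 0 < a by apply: lt_bigmin.
exists (a / (M * K ^+ n)); first by rewrite divr_gt0 // mulr_gt0 // exprn_gt0.
move=> y y0 fy yK I i IV iI.
rewrite ler_pdivrMr ?mulr_gt0 ?exprn_gt0 //.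
apply: le_trans (bigmin_le_cond _ _ IV) _.
have P0 : 0 < \prod_(j in I) y j 0 by exact: prodr_gt0.
have fI : absdet A (~: I)%SET / \prod_(j in I) y j 0 <= M.
  apply: le_trans fy; rewrite /inv_weight (bigD1 I) //= lerDl sumr_ge0 // => J /andP[JV _].
  by rewrite divr_ge0 ?ltW ?absdet_gt0 // prodr_gt0.
move: fI; rewrite ler_pdivrMr // => /le_trans; apply.
rewrite [leRHS]mulrCA ler_pM2l // (bigD1 i) //= ler_pM2l //.
apply: (@le_trans _ _ (\prod_(j in I | j != i) K)).
  by apply: ler_prod => j _; rewrite ltW //= yK.
by rewrite prodr_const ler_weXn2l // -[leqRHS]card_ord max_card.
Qed.

(** [z] is chosen so that [B *m z] pairs with kernel vectors as minus their [i]-th coordinate. If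
    the cone of [I] contains [z] and [v] is a point over [b] vanishing on [I], then [y i 0] is
    [v i 0] plus a nonnegative combination of the positive [y j 0] with [j] in [I]. If all
    coefficients are 0, coordinate [i] is constant on the fiber and equals [q i 0]. *)
Lemma orthant_pos_of_VC b y : (C `&` pos A) b -> A *m y = b ->
  (forall I i, I \in VC A C -> i \in I -> 0 < y i 0) -> orthant_pos y.
Proof.
move=> [bC [q q0 qb]] yb yV i.
pose z := - (invmx (B^T *m B) *m (row i B)^T).
have [I IV coef0] := normal_cover B_ker A_ge0 A_col cellC z.
have Ku := VC_unit B_ker A_ge0 A_col cellC IV.
have vI := VC_card B_ker A_ge0 A_col cellC IV.
have coordE (u w : 'cV[R]_n) : A *m u = A *m w -> w i 0 - u i 0 =
    \sum_j normal_coef B I z j 0 * (w (index_of mn I j) 0 - u (index_of mn I j) 0).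
  move=> uw; have := polar_pairing B_ker z Ku uw.
  have [t tE] : exists t, w - u = B *m t.
    by apply: (kerB_param B_ker); rewrite mulmxBr uw subrr.
  have -> : dotp (B *m z) (w - u) = - (w i 0 - u i 0).
    have Bz : B^T *m (B *m z) = - (row i B)^T.
      by rewrite mulmxA /z mulmxN mulKVmx // (gramB_unit B_ker).
    have -> : w i 0 - u i 0 = (B *m t) i 0 by rewrite -tE !mxE.
    rewrite dotpC tE /dotp trmx_mul -mulmxA Bz mulmxN -trmx_mul -row_mul.
    by rewrite mxE [in LHS]mxE [in LHS]mxE.
  move=> h; apply: oppr_inj; rewrite h -sumrN; apply: eq_bigr => j _.
  by rewrite -mulrN opprB.
have [v [v0 vb] vz] := VC_vertex B_ker A_ge0 A_col cellC IV bC.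
have yj j : 0 < y (index_of mn I j) 0 by apply: (yV I) => //; exact: index_of_in.
have [cpos|/existsNP] := pselect (forall j, normal_coef B I z j 0 = 0).
  have /eqP := @coordE q y (etrans qb (esym yb)).
  rewrite big1 => [|j _]; last by rewrite cpos mul0r.
  by rewrite subr_eq0 => /eqP ->.
move=> [j /eqP cj].
have := @coordE v y (etrans vb (esym yb)).
rewrite (bigD1 j) //= => h.
have : 0 < normal_coef B I z j 0 * (y (index_of mn I j) 0 - v (index_of mn I j) 0).
  by rewrite vz ?index_of_in // subr0 mulr_gt0 // lt_neqAle eq_sym cj coef0.
have : 0 <= \sum_(l | l != j) normal_coef B I z l 0 *
    (y (index_of mn I l) 0 - v (index_of mn I l) 0).
  by apply: sumr_ge0 => l _; rewrite vz ?index_of_in // subr0 mulr_ge0 // ltW.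
have := v0 i; lra.
Qed.

Lemma minimiser_exists b : (C `&` pos A) b -> exists x,
  [/\ orthant_pos x, A *m x = b &
      forall y, orthant_pos y -> A *m y = b -> f x <= f y].
Proof.
move=> Cb; have [bC [q q0 qb]] := Cb.
have [K0 K00 fK] := fiber_bound A_ge0 A_col.
(* The summand 1 ensures [1 <= K], as [weight_lower_bound] requires. *)
pose K := 1 + K0 * `|b|.
have K1 : 1 <= K by rewrite lerDl mulr_ge0.
have fq0 : 0 < f q.
  have [I IV _] := normal_cover B_ker A_ge0 A_col cellC 0.
  rewrite /inv_weight (bigD1 I) //=; apply: ltr_wpDr.
    by rewrite sumr_ge0 // => J /andP[JV _]; rewrite divr_ge0 ?ltW ?absdet_gt0 // prodr_gt0.
  by rewrite divr_gt0 ?absdet_gt0 // prodr_gt0.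
have [e e0 lower] := weight_lower_bound fq0 K1.
have bounded y : orthant_pos y -> A *m y = b -> forall i, y i 0 <= K.
  move=> y0 yb i; apply: le_trans (fK _ _ i) _; first by move=> j; exact: ltW.
  by rewrite yb /K lerDr.
(* A compact set inside the open orthant that contains every positive point over [b] of weight at
   most [f q]. *)
pose S := fiber A b `&` [set y | forall I i, I \in VC A C -> i \in I -> e <= y i 0].
have Spos y : S y -> orthant_pos y.
  move=> [[y0 yb] ye]; apply: (orthant_pos_of_VC Cb yb) => I i IV iI.
  by apply: lt_le_trans e0 _; exact: ye IV iI.
have cS : compact S.
  apply: compact_closedI; first exact: fiber_compact.
  apply: closed_forall => I; apply: closed_forall => i.
  have [IV|IV] := boolP (I \in VC A C); last first.
    by rewrite [X in closed X](_ : _ = setT); [exact: closedT|apply/seteqP; split].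
  have [iI|iI] := boolP (i \in I); last first.
    by rewrite [X in closed X](_ : _ = setT); [exact: closedT|apply/seteqP; split].
  have := @closed_coord_ge R n i e; congr (closed _).
  by apply/seteqP; split => y /=; [|apply].
have Sq : S q.
  split; first by split => // i; exact: ltW.
  by move=> I i IV iI; apply: lower IV iI => //; exact: bounded.
have [|x Sx xmin] := compact_min cS (ex_intro _ q Sq) (f := f).
  move=> x /set_mem Sx; apply: (@inv_weight_cvg _ _ _ A _ _ (nbhs x) _ id x).
    exact: Spos.
  exact: cvg_id.
exists x; split; [exact: Spos|by case: Sx => -[]|].
move=> y y0 yb; have [fy|fy] := leP (f y) (f q); last first.
  by apply: le_trans (ltW fy); exact: xmin.
apply: xmin; split; first by split => // i; exact: ltW.
by move=> I i IV iI; apply: lower IV iI => //; exact: bounded.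
Qed.

Lemma santalo_pointP b x : (C `&` pos A) b ->
  is_santalo_point A B b x <-> [/\ orthant_pos x, A *m x = b &
     forall y, orthant_pos y -> A *m y = b -> f x <= f y].
Proof.
move=> [bC bpos].
have volE y : orthant_pos y -> A *m y = b ->
    vol (polar_at (Qpoly A B b) (B^T *m y)) = (polar_const B A_rank * f y)%:E.
  by move=> y0 yb; rewrite -yb (vol_polar A_rank B_ker A_ge0 A_col cellC) // yb.
have c0 := polar_const_gt0 A_rank B_ker.
rewrite /is_santalo_point relint_fiber //; split.
  move=> [[x0 xb] xmin]; split => // y y0 yb.
  have := xmin y; rewrite relint_fiber // => /(_ (conj y0 yb)).
  by rewrite !volE // lee_fin ler_pM2l.
move=> [x0 xb xmin]; split => // y; rewrite relint_fiber // => -[y0 yb].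
by rewrite !volE // lee_fin ler_pM2l // xmin.
Qed.

Lemma santalo_mapP b : (C `&` pos A) b ->
  [/\ orthant_pos (santalo_map A B b), A *m santalo_map A B b = b &
    forall y, orthant_pos y -> A *m y = b -> f (santalo_map A B b) <= f y].
Proof.
move=> Cb; apply/(santalo_pointP _ Cb); apply: (@xgetPex _ 0 (is_santalo_point A B b)).
by have [x /(santalo_pointP x Cb)] := minimiser_exists Cb; exists x.
Qed.

Lemma santalo_map_critical b t : (C `&` pos A) b ->
  weight_slope A C (santalo_map A B b) (B *m t) = 0.
Proof.
move=> Cb; have [x0 xb xmin] := santalo_mapP Cb.
apply: (minimiser_critical A_rank B_ker A_ge0 A_col cellC) => //.
by rewrite xb.
Qed.

Lemma minimiser_unique x y : orthant_pos x -> orthant_pos y -> A *m x = A *m y ->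
  (forall t, weight_slope A C x (B *m t) = 0) -> f y <= f x -> y = x.
Proof.
move=> x0 y0 xy crit yx; apply: contrapT => /eqP ynx.
have := critical_minimiser A_rank B_ker A_ge0 A_col cellC x0 crit y0 (esym xy) ynx.
by rewrite ltNge yx.
Qed.

Lemma critical_santalo_map x : orthant_pos x -> (C `&` pos A) (A *m x) ->
  (forall t, weight_slope A C x (B *m t) = 0) -> santalo_map A B (A *m x) = x.
Proof.
move=> x0 Cb crit; have [y0 yb ymin] := santalo_mapP Cb.
by apply: minimiser_unique => //; apply: ymin.
Qed.

(** Competitors over nearby [c] that tend to [x] bound the minimal values from above. So the
    minimisers eventually stay in a compact set, and each cluster point is a positive point over [b]
    of weight at most [f x], hence [x] itself. *)
Lemma santalo_map_continuous b : (C `&` pos A) b ->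
  santalo_map A B @ within (C `&` pos A) (nbhs b) --> santalo_map A B b.
Proof.
move=> Cb; have [x0 xb xmin] := santalo_mapP Cb.
set x := santalo_map A B b in x0 xb xmin *.
have crit t := santalo_map_critical t Cb; rewrite -/x in crit.
set F := within _ _.
have FF : ProperFilter F.
  by apply: within_nbhs_proper; apply: subset_closure.
have Fin : F (C `&` pos A) by exact: withinT.
have FidF : id @ F --> b by exact: cvg_within.
have /row_freeP[N AN] : row_free A by rewrite /row_free A_rank.
(* The competitor over [c], built from a right inverse of [A]. *)
pose g c := x + N *m (c - b).
have gF : g @ F --> x.
  suff : g @ F --> x + N *m (b - b) by rewrite subrr mulmx0 addr0.
  apply: (@cvgD _ _ _ F _ (fun=> x) (fun c => N *m (c - b))).
    exact: cvg_cst.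
  apply: (@cvg_mulmx _ _ F _ _ _ _ N (fun c => c - b)).
  by apply: cvgB; [exact: FidF|exact: cvg_cst].
have Ag c : A *m g c = c by rewrite mulmxDr mulmxA AN mul1mx xb addrC subrK.
have fF (h : R) : 0 < h -> \forall c \near F, f (santalo_map A B c) < f x + h.
  move=> h0.
  have fg : \forall c \near F, f (g c) < f x + h.
    apply: (@cvgr_lt _ _ F _ (fun c => f (g c)) (f x)); last by rewrite ltrDl.
    exact: inv_weight_cvg.
  have gpos : \forall c \near F, orthant_pos (g c) by exact: (gF _ (near_orthant_pos x0)).
  apply: filterS3 Fin fg gpos => c Cc fgc gc.
  have [_ _ cmin] := santalo_mapP Cc.
  by apply: le_lt_trans fgc; apply: cmin.
have fx0 : 0 < f x.
  have [I IV _] := normal_cover B_ker A_ge0 A_col cellC 0.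
  rewrite /inv_weight (bigD1 I) //=; apply: ltr_wpDr.
    by rewrite sumr_ge0 // => J /andP[JV _]; rewrite divr_ge0 ?ltW ?absdet_gt0 // prodr_gt0.
  by rewrite divr_gt0 ?absdet_gt0 // prodr_gt0.
have [K0 K00 fK] := fiber_bound A_ge0 A_col.
pose K := 1 + K0 * (`|b| + 1).
have K1 : 1 <= K by rewrite lerDl mulr_ge0 // addr_ge0.
have M0 : 0 < f x + 1 by rewrite addr_gt0.
have [e e0 lower] := weight_lower_bound M0 K1.
have bnd c : `|c| <= `|b| + 1 -> forall y, orthant_pos y -> A *m y = c ->
    forall i, y i 0 <= K.
  move=> cb y y0 yc i; apply: le_trans (fK _ _ i) _; first by move=> j; exact: ltW.
  rewrite yc /K; apply: (@le_trans _ _ (K0 * (`|b| + 1))); last by rewrite lerDr.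
  by rewrite ler_wpM2l.
(* The bounds [e] and [K] are relaxed to [e / 2] and [K + 1] so that [V] is a neighbourhood of [x]
   as well as compact. *)
pose V := [set y : 'cV[R]_n | (forall i, `|y i 0| <= K + 1) /\
  forall I i, I \in VC A C -> i \in I -> e / 2 <= y i 0].
have clV : closed V.
  apply: closedI.
    apply: closed_forall => i.
    rewrite [X in closed X](_ : _ = [set y : 'cV[R]_n | - (K + 1) <= y i 0] `&`
      [set y : 'cV[R]_n | y i 0 <= K + 1]).
      by apply: closedI; [exact: closed_coord_ge|exact: closed_coord_le].
    by apply/seteqP; split => y /=; rewrite ler_norml => /andP.
  apply: closed_forall => I; apply: closed_forall => i.
  have [IV|IV] := boolP (I \in VC A C); last first.
    by rewrite [X in closed X](_ : _ = setT); [exact: closedT|apply/seteqP; split].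
  have [iI|iI] := boolP (i \in I); last first.
    by rewrite [X in closed X](_ : _ = setT); [exact: closedT|apply/seteqP; split].
  have := @closed_coord_ge R n i (e / 2); congr (closed _).
  by apply/seteqP; split => y /=; [|apply].
have cV : compact V by apply: cV_compact clV _ => y [].
have xV : nbhs x V.
  have xK i : x i 0 <= K by apply: (bnd b) => //; rewrite lerDl.
  have xe I i : I \in VC A C -> i \in I -> e <= x i 0.
    by move=> IV iI; apply: lower IV iI => //; rewrite lerDl.
  have n1 : nbhs x [set y : 'cV[R]_n | forall i, `|y i 0| <= K + 1].
    apply: (@filter_forall _ _ (fun i (y : 'cV[R]_n) => `|y i 0| <= K + 1) (nbhs x)) => i.
    have : nbhs x [set y : 'cV[R]_n | `|y i 0| < K + 1].
      apply: (@cvgr_lt _ _ (nbhs x) _ (fun y : 'cV[R]_n => `|y i 0|) `|x i 0|).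
        by apply: cvg_norm; exact: coord_continuous.
      by rewrite gtr0_norm // ltr_pwDr.
    by apply: filterS => y /ltW.
  have n2 : nbhs x [set y : 'cV[R]_n | forall i, e / 2 <= y i 0 \/
      ~ (exists2 I, I \in VC A C & i \in I)].
    apply: (@filter_forall _ _ (fun i (y : 'cV[R]_n) => e / 2 <= y i 0 \/
      ~ (exists2 I, I \in VC A C & i \in I)) (nbhs x)) => i.
    have [[I IV iI]|no] := pselect (exists2 I, I \in VC A C & i \in I); last first.
      by apply: nearW; right.
    have : nbhs x [set y : 'cV[R]_n | e / 2 < y i 0].
      apply: (@cvgr_gt _ _ (nbhs x) _ (fun y : 'cV[R]_n => y i 0) (x i 0)).
        exact: coord_continuous.
      apply: lt_le_trans (xe I i IV iI).
      by rewrite ltr_pdivrMr // ltr_pMr // ltr1n.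
    by apply: filterS => y /ltW; left.
  apply: filterS2 n1 n2 => y h1 h2; split => // I i IV iI.
  by case: (h2 i) => // -[]; exists I.
have normF : \forall c \near F, `|c| <= `|b| + 1.
  have : \forall c \near F, `|c| < `|b| + 1.
    apply: (@cvgr_lt _ _ F _ (fun c => `|c|) `|b|); last by rewrite ltrDl.
    by apply: cvg_norm; exact: FidF.
  by apply: filterS => c /ltW.
have FV : F (santalo_map A B @^-1` V).
  apply: filterS3 Fin normF (fF 1 ltr01) => c Cc cn fc.
  have [y0 yc _] := santalo_mapP Cc; split.
    by move=> i; rewrite gtr0_norm //; apply: le_trans (bnd c cn _ y0 yc i) _; rewrite lerDl.
  move=> I i IV iI; apply: (@le_trans _ _ e).
    by rewrite ler_pdivrMr // ler_pMr // ler1n.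
  by apply: (lower _ y0 (ltW fc) (bnd c cn _ y0 yc)) IV iI.
have cluster_x y : cluster (santalo_map A B @ F) y -> y = x.
  move=> cly.
  have inV : V y.
    apply: clV => W Wy; exact: (cly _ _ FV Wy).
  have Ay : A *m y = b.
    apply: (@norm_hausdorff R 'cV[R]_d) => P Q Py Qb.
    have h1 : nbhs y [set y' | P (A *m y')] by exact: mulmx_continuous.
    have h2 : F (santalo_map A B @^-1` [set y' | Q (A *m y')]).
      apply: filterS2 Fin (FidF _ Qb) => c Cc Qc.
      by have [_ yc _] := santalo_mapP Cc; rewrite /preimage /= yc.
    by have [y' [? ?]] := cly _ _ h2 h1; exists (A *m y').
  have y0 : orthant_pos y.
    apply: (orthant_pos_of_VC Cb Ay) => I i IV iI; case: inV => _ /(_ I i IV iI).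
    by apply: lt_le_trans; rewrite divr_gt0.
  apply: minimiser_unique => //; first by rewrite xb Ay.
  rewrite leNgt; apply/negP => fxy.
  pose h := (f y - f x) / 2.
  have h0 : 0 < h by rewrite divr_gt0 // subr_gt0.
  have h1 : \forall y' \near y, f x + h < f y'.
    apply: (@cvgr_gt _ _ (nbhs y) _ f (f y)).
      by apply: (@inv_weight_cvg _ _ _ A _ _ (nbhs y) _ id y y0); exact: cvg_id.
    by rewrite /h; lra.
  have [y' [/= h2 h3]] := cly [set y' | f y' < f x + h] _ (fF h h0) h1.
  by have := lt_trans h2 h3; rewrite ltxx.
have PF : ProperFilter (santalo_map A B @ F) by exact: fmap_proper_filter.
apply: (compact_cluster_set1 (@norm_hausdorff R 'cV[R]_n) cV xV PF FV).
apply/seteqP; split => y; first exact: cluster_x.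
(* Compactness provides some cluster point, and it can only be [x]. *)
move=> ->; have [z [_ clz]] := cV _ PF FV.
by rewrite -(cluster_x z clz).
Qed.

End Cell.
End SantaloPoint.

(** * The equations of a patch as criticality of the weight *)

Section SantaloPatch.
Variables (R : realType) (d n : nat) (A : 'M[R]_(d, n)) (B : 'M[R]_(n, n - d)).
Hypotheses (A_rank : \rank A = d) (B_ker : is_ker_basis A B).
Hypotheses (A_ge0 : forall i j, 0 <= A i j) (A_col : forall j, col j A != 0).

Local Notation m := (n - d)%N.

(** Meant for [alpha], which has degree at most one in each variable: its difference quotients along
    a coordinate are constant. *)
Lemma derive_affine (g : 'cV[R]_n -> R) (x v : 'cV[R]_n) (D : R) :
  (forall h, g (h *: v + x) = g x + h * D) -> 'D_v g x = D.
Proof.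
move=> gD; apply/cvg_lim => //; apply: cvg_near_cst.
near=> h; have h0 : h != 0 by near: h; exact: nbhs_dnbhs_neq.
by rewrite /= gD addrC addKr /GRing.scale /= mulKf.
Unshelve. all: by end_near. Qed.

Variable C : set 'cV[R]_d.
Hypothesis cellC : cells A C.
Local Notation f := (inv_weight A C).
Local Notation F := (FC A C).
Local Notation w x I := (absdet A (~: I)%SET / \prod_(i in I) x i 0).

Lemma derive_alpha (x : 'cV[R]_n) i : i \in F -> 'D_(delta_mx i 0) (alpha A C) x =
  \sum_(I in VC A C | i \notin I)
    absdet A (~: I)%SET * \prod_(k in (F :\: I)%SET | k != i) x k 0.
Proof.
move=> iF; apply: derive_affine => h.
rewrite big_mkcondr /= mulr_sumr /alpha -big_split /=; apply: eq_bigr => I IV.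
have coordE k : (h *: delta_mx i 0 + x) k 0 = x k 0 + h * (k == i)%:R.
  by rewrite !mxE eqxx andbT addrC.
case: ifPn => iI.
  have iFI : i \in (F :\: I)%SET by rewrite finset.in_setD iI.
  rewrite (bigD1 i) //= coordE eqxx mulr1 [in RHS](bigD1 i) //=.
  rewrite (eq_bigr (fun k => x k 0)) => [|k /andP[_ ki]]; first by ring.
  by rewrite coordE (negPf ki) mulr0 addr0.
rewrite mulr0 addr0; congr (_ * _); apply: eq_bigr => k.
rewrite finset.in_setD => /andP[kI _]; rewrite coordE.
have -> : (k == i) = false by apply: contraNF kI => /eqP ->; rewrite negbK in iI.
by rewrite mulr0 addr0.
Qed.

Lemma prod_FC_VC (x : 'cV[R]_n) I : I \in VC A C -> orthant_pos x ->
  \prod_(k in (F :\: I)%SET) x k 0 = \prod_(k in F) x k 0 / \prod_(k in I) x k 0.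
Proof.
move=> IV x0; rewrite [in RHS](big_setID I) /=.
have /finset.setIidPr -> := VC_sub_FC IV.
by rewrite mulrAC divff ?mul1r // gt_eqF // prodr_gt0.
Qed.

Lemma alphaE (x : 'cV[R]_n) : orthant_pos x -> alpha A C x = \prod_(k in F) x k 0 * f x.
Proof.
move=> x0; rewrite /alpha /inv_weight mulr_sumr; apply: eq_bigr => I IV.
by rewrite (prod_FC_VC IV) // mulrCA.
Qed.

Lemma inv_weight_gt0 (x : 'cV[R]_n) : orthant_pos x -> 0 < f x.
Proof.
move=> x0; have [I IV _] := normal_cover B_ker A_ge0 A_col cellC 0.
have ad J : J \in VC A C -> 0 < absdet A (~: J)%SET.
  exact: (absdet_VC_gt0 A_rank B_ker A_ge0 A_col cellC).
rewrite /inv_weight (bigD1 I) //=; apply: ltr_wpDr.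
  by rewrite sumr_ge0 // => J /andP[JV _]; rewrite divr_ge0 ?ltW ?ad // prodr_gt0.
by rewrite divr_gt0 ?ad // prodr_gt0.
Qed.

(** By [alphaE], [alpha] is [f] times the product over [F]. The logarithmic derivative of that
    product is exactly the subtracted [(x i 0)^-1], which leaves that of [f]. *)
Lemma log_derive_alpha (x : 'cV[R]_n) i : i \in F -> orthant_pos x ->
  'D_(delta_mx i 0) (alpha A C) x / alpha A C x - (x i 0)^-1 =
  - (f x)^-1 * (\sum_(I in VC A C | i \in I) w x I / x i 0).
Proof.
move=> iF x0; have f0 := inv_weight_gt0 x0.
have X0 : 0 < \prod_(k in F) x k 0 by apply: prodr_gt0.
have DE : 'D_(delta_mx i 0) (alpha A C) x =
    \prod_(k in F) x k 0 / x i 0 * \sum_(I in VC A C | i \notin I) w x I.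
  rewrite derive_alpha // mulr_sumr; apply: eq_bigr => I /andP[IV iI].
  have iFI : i \in (F :\: I)%SET by rewrite finset.in_setD iI.
  have := prod_FC_VC IV x0; rewrite (bigD1 i) //= => E.
  apply: (mulfI (lt0r_neq0 (x0 i))); rewrite mulrCA E.
  by field; rewrite ?gt_eqF // prodr_gt0.
have fE : f x = \sum_(I in VC A C | i \in I) w x I + \sum_(I in VC A C | i \notin I) w x I.
  by rewrite /inv_weight (bigID (fun I : {set 'I_n} => i \in I)).
rewrite DE alphaE // -mulr_suml.
move: f0; rewrite fE; set s := \sum_(I in _ | _) _; set s' := \sum_(I in _ | _) _ => f0.
field; rewrite !gt_eqF //.
Qed.

Lemma patch_equation (x t : 'cV[R]_n) : orthant_pos x ->
  \sum_(i in F) t i 0 * ('D_(delta_mx i 0) (alpha A C) x / alpha A C x - (x i 0)^-1) =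
  - (f x)^-1 * weight_slope A C x t.
Proof.
move=> x0.
rewrite (eq_bigr (fun i => - (f x)^-1 *
  (\sum_(I in VC A C | i \in I) w x I * (t i 0 / x i 0)))); last first.
  move=> i iF; rewrite log_derive_alpha // mulrCA; congr (_ * _).
  by rewrite mulr_sumr; apply: eq_bigr => I _; rewrite mulrCA [in RHS]mulrA; ring.
rewrite -mulr_sumr; congr (_ * _).
rewrite (exchange_big_dep (mem (VC A C))) /=; last by move=> i I _ /andP[].
apply: eq_bigr => I IV; rewrite mulr_sumr; apply: eq_bigl => i.
rewrite IV /=; apply/andP/idP => [[]//|iI]; split => //.
by move/fintype.subsetP: (VC_sub_FC IV); apply.
Qed.

(** Pairing the vector equation with an arbitrary [t] gives the slope in direction [B *m t], up to
    the nonzero factor [- (f x)^-1]. *)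
Lemma santalo_patchP x : santalo_patch A B C x <->
  [/\ orthant_pos x, (C `&` pos A) (A *m x) &
      forall t, weight_slope A C x (B *m t) = 0].
Proof.
set c := fun i => 'D_(delta_mx i 0) (alpha A C) x / alpha A C x - (x i 0)^-1.
have E (t : 'cV[R]_m) : orthant_pos x ->
   (t^T *m ((rowsub (fun j : 'I_#|F| => enum_val j) B)^T *m
       \col_(j < #|F|) c (enum_val j))) 0 0 = - (f x)^-1 * weight_slope A C x (B *m t).
  move=> x0; rewrite -patch_equation // mulmxA -trmx_mul mxE [RHS]big_enum_val /=.
  apply: eq_bigr => j _; rewrite !mxE; congr (_ * _).
  by apply: eq_bigr => k _; rewrite !mxE.
split=> [[x0 Cx eq0]|[x0 Cx crit]]; split => //.
  move=> t; have := E t x0; rewrite eq0 mulmx0 mxE => /esym/eqP.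
  by rewrite mulf_eq0 oppr_eq0 invr_eq0 gt_eqF ?inv_weight_gt0 //= => /eqP.
apply/matrixP => i j; rewrite [RHS]mxE ord1.
have := E (delta_mx i 0) x0; rewrite crit mulr0 trmx_delta -rowE mxE.
by [].
Qed.

End SantaloPatch.

Theorem corollary3p3 (R : realType) (d n : nat)
  (A : 'M[R]_(d, n)) (B : 'M[R]_(n, n - d))
  (A_ge0 : forall i j, 0 <= A i j)
  (A_rank : \rank A = d)
  (A_col : forall j, col j A != 0)
  (B_ker : is_ker_basis A B) :
  (forall C, cells A C ->
     homeomorphism_on (C `&` pos A) (santalo_patch A B C) (santalo_map A B)) /\
  santalo_patchwork A B = \bigcup_(C in cells A) santalo_patch A B C.
Proof.
have patchP C (cC : cells A C) x :=
  santalo_patchP (B := B) A_rank B_ker A_ge0 A_col cC x.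
have map_in C b : cells A C -> (C `&` pos A) b -> santalo_patch A B C (santalo_map A B b).
  move=> cC Cb; have [x0 xb _] := santalo_mapP A_rank B_ker A_ge0 A_col cC Cb.
  apply/(patchP C cC); split => //; first by rewrite xb.
  by move=> t; exact: (santalo_map_critical A_rank B_ker A_ge0 A_col).
have map_mulmx C x : cells A C -> santalo_patch A B C x ->
    santalo_map A B (A *m x) = x.
  move=> cC /(patchP C cC)[x0 Cx crit].
  exact: (critical_santalo_map A_rank B_ker A_ge0 A_col cC).
split.
  move=> C cC; exists (mulmx A); split.
  - by move=> b Cb; exact: map_in.
  - by move=> x /(patchP C cC)[].
  - move=> b /set_mem Cb.
    by have [_ xb _] := santalo_mapP A_rank B_ker A_ge0 A_col cC Cb.
  - by move=> x /set_mem xS; exact: (map_mulmx C).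
  - split; last by apply: continuous_subspaceT; exact: mulmx_continuous.
    apply/subspace_continuousP => b Cb.
    exact: (santalo_map_continuous A_rank B_ker A_ge0 A_col cC Cb).
apply/seteqP; split => [_ [b bpos <-]|x [C cC xS]].
  have [C cC Cb] := cells_cover A_ge0 A_col A_rank bpos.
  by exists C => //; apply: map_in.
have /(patchP C cC)[x0 [Cx px] crit] := xS.
by exists (A *m x) => //; exact: (map_mulmx C).
Qed.
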